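(* Let $\chi$ be a non-trivial Dirichlet character modulo $q$ and $r$ a non-negative integer. Then $$L(-r,\chi)=r!\,q^r\sum_{k=0}^{r}\frac{(-1)^{k-1}\alpha_k(-r)}{(r+1-k)!}\sum_{m=1}^{q-1}\chi(m)\,(m/q-1)(m/q-2)\cdots(m/q+k-r-1).$$
   Context: For $s\in\mathbb{C}$ the coefficients $\alpha_k(s)$ are defined by $\left(\frac{-\log(1-t)}{t}\right)^{s-1}=\sum_{k=0}^\infty\alpha_k(s)t^k$ for $|t|<1$ (branch equal to $1$ at $t=0$). $L(s,\chi)$ is the Dirichlet $L$-function, analytically continued. The product $(m/q-1)\cdots(m/q+k-r-1)$ consists of the $r+1-k$ factors $m/q-i$ for $i=1,\dots,r+1-k$. *)

(* Defs.v *)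
From HB Require Import structures.
From mathcomp Require Import all_boot all_order all_algebra.
From mathcomp Require Import complex.
From mathcomp Require Import all_classical all_reals all_analysis.
Set Implicit Arguments.
Unset Strict Implicit.
Unset Printing Implicit Defensive.
Import Order.TTheory GRing.Theory Num.Theory.
Import numFieldNormedType.Exports.
Local Open Scope ring_scope.
Local Open Scope complex_scope.
Local Open Scope classical_set_scope.

Section Defs.
Variable R : realType.
Local Notation C := (R[i]).

Definition dirichlet_character (q : nat) (chi : nat -> C) : Prop :=
  [/\ chi 1%N = 1,
      (forall m n : nat, chi (m * n)%N = chi m * chi n),
      (forall n : nat, chi (n + q)%N = chi n) &
      (forall n : nat, (chi n == 0) = ~~ coprime n q)].

Definition nontrivial_character (q : nat) (chi : nat -> C) : Prop :=
  exists n : nat, coprime n q /\ chi n != 1.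

(* n^(-s) = exp(-s log n) for a positive integer n and s = a + i b:
   n^(-s) = n^(-a) (cos(b log n) - i sin(b log n)). *)
Definition npow_neg (n : nat) (s : C) : C :=
  let: a +i* b := s in
  let L := ln (n%:R : R) in
  (expR (- (a * L)) * cos (b * L)) +i* (- (expR (- (a * L)) * sin (b * L))).

Definition realpart (s : C) : R := let: a +i* _ := s in a.

Definition dir_partial (chi : nat -> C) (s : C) (N : nat) : C :=
  \sum_(1 <= n < N) chi n * npow_neg n s.

Definition is_L_continuation (chi : nat -> C) (f : C -> C) : Prop :=
  (forall z : C, derivable (f : C^o -> C^o) z 1) /\
  (forall s : C, 1 < realpart s ->
     (dir_partial chi s : nat -> C^o) @ \oo --> (f s : C^o)).

Definition binomC (x : C) (j : nat) : C :=
  (\prod_(i < j) (x - i%:R)) / (j`!)%:R.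

(* u_k(t) = sum_{i=1}^{k} t^i/(i+1), the truncation at degree k of
   -log(1-t)/t - 1 *)
Definition uk (k : nat) : {poly C} :=
  \poly_(i < k.+1) (if i == 0%N then 0 else ((i.+1)%:R)^-1).

(* alpha_k(s) = [t^k] (-log(1-t)/t)^(s-1) = [t^k] (1 + u(t))^(s-1)
             = sum_{j=0}^{k} binom(s-1, j) [t^k] u(t)^j
   (binomial series of the branch equal to 1 at t = 0) *)
Definition alpha (k : nat) (s : C) : C :=
  \sum_(j < k.+1) binomC (s - 1) j * ((uk k) ^+ j)`_k.

End Defs.

(* Main.v *)
(**
   Uniqueness of the continuation.  Goursat's theorem applied to
   [G (s + exp z)] on a rectangle of height [2 pi] gives the mean value
   property of an entire [G], hence [|G s| <= 2 sup |G (s + w)|] over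
   [|w| = 1].  Multiplying by [exp (lam (w + w^2/2))] turns this into
   propagation of convergence: if entire functions [G n] are locally uniformly
   Cauchy and tend to an entire [f] on [Re > 1], they tend to [f] further to
   the left as well.

   The approximants.  Let [avg] replace a sequence by its mean over [q]
   consecutive terms and apply it [j = r + 3] times to the partial sums of the
   Dirichlet series.  Since [chi] has mean zero over a period, each averaging
   of [chi n * n^-s] trades [n^-s] for its differences, so the increments
   become [O(n^-2)] on [Re s >= - r - 1].

   The value at [- r].  If [Q] is a polynomial with [Q (x + q) - Q x = x^r],
   the partial sums at [s = - r] are [U n - U 1] with
   [U n = sum_(a < q) chi (n + a) Q (n + a)]; iterated averaging kills [U], so
   [L (- r) = - U 1].  That the polynomial of the statement is such a [Q] is the
   identity [[t^r] (1 - t)^(y-1) (- log (1 - t) / t)^(-r-1) = (- y)^r / r!],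
   which follows by induction on [r] from an integration by parts.
*)
Require Import Defs.
From HB Require Import structures.
From mathcomp Require Import all_boot all_order all_algebra.
From mathcomp Require Import complex.
From mathcomp Require Import all_classical all_reals all_analysis.
From mathcomp Require Import zify ring lra.
Set Implicit Arguments.
Unset Strict Implicit.
Unset Printing Implicit Defensive.
Import Order.TTheory GRing.Theory Num.Theory.
Import numFieldNormedType.Exports.
Import Normc.
Local Open Scope ring_scope.

(** * Powers of the logarithm series *)

Section TruncatedCongruence.
Variable K : comNzRingType.
Implicit Types p q : {poly K}.

(** Congruence modulo ['X^n]: power series identities are stated for truncating polynomials, each
    with the precision it has. *)
Definition eq_upto (n : nat) p q := forall i, (i < n)%N -> p`_i = q`_i.

Lemma eq_upto_trans n p q s : eq_upto n p q -> eq_upto n q s -> eq_upto n p s.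
Proof. by move=> h h' i lin; rewrite h// h'. Qed.

Lemma eq_uptoM n p p' q q' :
  eq_upto n p p' -> eq_upto n q q' -> eq_upto n (p * q) (p' * q').
Proof.
move=> hp hq i lin; rewrite !coefM; apply: eq_bigr => j _; rewrite hp ?hq//.
- by rewrite (leq_ltn_trans (leq_subr _ _)).
- by rewrite (leq_ltn_trans _ lin)// -ltnS.
Qed.

Lemma eq_uptoMl n p q q' : eq_upto n q q' -> eq_upto n (p * q) (p * q').
Proof. exact: eq_uptoM. Qed.

Lemma eq_uptoMr n p p' q : eq_upto n p p' -> eq_upto n (p * q) (p' * q).
Proof. by move=> h; exact: eq_uptoM. Qed.

Lemma eq_uptoX n p q j : eq_upto n p q -> eq_upto n (p ^+ j) (q ^+ j).
Proof. by move=> h; elim: j => // j IH; rewrite !exprS; exact: eq_uptoM. Qed.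

(** ['X] divides [p], so ['X^j] divides [p ^+ j]. This is what lets binomial series in [u] be cut
    off. *)
Lemma coef_exp_small p (j i : nat) : p`_0 = 0 -> (i < j)%N -> (p ^+ j)`_i = 0.
Proof.
move=> p0; elim: j i => // j IH i; rewrite ltnS exprS coefM => lij.
apply: big1 => -[[|m] /=]; first by rewrite p0 mul0r.
move=> hm _; by rewrite IH ?mulr0//; lia.
Qed.

End TruncatedCongruence.

Section LogarithmSeries.
Variable R : realType.
Local Notation C := R[i].
Implicit Types (y c s : C) (n k : nat).

Lemma binomC0 y : binomC y 0 = 1.
Proof. by rewrite /binomC big_ord0 fact0 divr1. Qed.

Lemma binomC_absorb y n :
  (n.+1)%:R * binomC y n.+1 = y * binomC (y - 1) n.
Proof.
rewrite /binomC big_ord_recl subr0 factS natrM invfM.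
have -> : \prod_(i < n) (y - (lift ord0 i)%:R) = \prod_(i < n) (y - 1 - i%:R).
  by apply: eq_bigr => i _; rewrite lift0 -natr1; ring.
have n0 : (n.+1)%:R != 0 :> C by rewrite pnatr_eq0.
have f0 : (n`!)%:R != 0 :> C by rewrite pnatr_eq0 -lt0n fact_gt0.
by field; rewrite f0 nat1r n0.
Qed.

Lemma binomC_recr y n : (n.+1)%:R * binomC y n.+1 = (y - n%:R) * binomC y n.
Proof.
rewrite /binomC big_ord_recr factS natrM invfM /=.
have n0 : (n.+1)%:R != 0 :> C by rewrite pnatr_eq0.
have f0 : (n`!)%:R != 0 :> C by rewrite pnatr_eq0 -lt0n fact_gt0.
by field; rewrite f0 nat1r n0.
Qed.

Lemma binomC_pascal y n :
  binomC y n.+1 = binomC (y - 1) n.+1 + binomC (y - 1) n.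
Proof.
have n0 : (n.+1)%:R != 0 :> C by rewrite pnatr_eq0.
apply: (mulfI n0); rewrite mulrDr binomC_absorb binomC_recr -natr1; ring.
Qed.

Variable N : nat.
Local Notation u := (uk R N).
Local Notation "p =_( n ) q" := (eq_upto n p q) (at level 70).

(** Truncated binomial series of [(- log (1 - t) / t)^c], whose base is [1 + u]; the exponent
    [c = s - 1] generates the [alpha k s]. *)
Let ell_power c : {poly C} := \sum_(j < N.+1) binomC c j *: u ^+ j.
(** Truncated binomial series of [(1 - t)^y]. *)
Let one_sub_power y : {poly C} := \poly_(i < N.+1) ((-1) ^+ i * binomC y i).

Let u0 : u`_0 = 0. Proof. by rewrite coef_poly. Qed.

(** [alpha] truncates at degree [k] and [ell_power] at [N]. The coefficient of degree [k] sees
    neither the coefficients of [u] beyond [k] nor the powers [u ^+ j] with [k < j]. *)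
Lemma alpha_ell_power k s : (k <= N)%N -> alpha k s = (ell_power (s - 1))`_k.
Proof.
move=> kN; rewrite /ell_power coef_sum /alpha.
rewrite -(big_mkord xpredT (fun j => binomC (s - 1) j * ((uk R k) ^+ j)`_k)).
rewrite -(big_mkord xpredT (fun j => (binomC (s - 1) j *: u ^+ j)`_k)).
rewrite [RHS](@big_cat_nat _ _ _ k.+1)//= [X in _ = _ + X]big_nat_cond.
rewrite [X in _ = _ + X]big1 ?addr0; last first.
  move=> j /andP[/andP[kj _] _]; rewrite coefZ coef_exp_small ?mulr0//.
apply: eq_bigr => j _; rewrite coefZ; congr (_ * _).
have h : uk R k =_(k.+1) u.
  by move=> i lik; rewrite !coef_poly lik ltnS (leq_trans _ kN)// -ltnS.
exact: (eq_uptoX j h).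
Qed.

(** Pascal's rule; the surplus term in [u ^+ N.+1] starts in degree [N.+1]. *)
Lemma ell_power_mul c : (1 + u) * ell_power (c - 1) =_(N.+1) ell_power c.
Proof.
move=> i iN; rewrite mulrDl mul1r.
have -> : ell_power c = ell_power (c - 1) +
    \sum_(j < N) binomC (c - 1) j *: u ^+ j.+1.
  rewrite /ell_power big_ord_recl [in RHS]big_ord_recl !binomC0 -addrA.
  congr (_ + _); rewrite -big_split; apply: eq_bigr => j _.
  by rewrite lift0 binomC_pascal scalerDl.
rewrite !coefD; congr (_ + _).
rewrite /ell_power mulr_sumr big_ord_recr/= coefD -scalerAr -exprS.
rewrite coefZ coef_exp_small// mulr0 addr0; congr (nth 0 (polyseq _) i).
by apply: eq_bigr => j _; rewrite -scalerAr exprS.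
Qed.

Lemma deriv_ell_power c :
  (ell_power c)^`() =_(N) c *: (ell_power (c - 1) * u^`()).
Proof.
move=> i iN; have -> : (ell_power c)^`() =
    c *: \sum_(j < N) binomC (c - 1) j *: (u ^+ j * u^`()).
  rewrite /ell_power linear_sum/= big_ord_recl expr0 derivZ derivC scaler0 add0r.
  rewrite scaler_sumr; apply: eq_bigr => j _.
  rewrite lift0 derivZ deriv_exp -scaler_nat !scalerA [_ * _%:R]mulrC.
  by rewrite binomC_absorb [u^`() * _]mulrC.
rewrite /ell_power mulr_suml [in RHS]big_ord_recr /= scalerDr coefD.
rewrite [X in _ = _ + X](_ : _ = 0) ?addr0.
  by under [in RHS]eq_bigr do rewrite -scalerAl.
rewrite coefZ coefM big1 ?mulr0// => j _.
by rewrite coefZ coef_exp_small ?mulr0 ?mul0r// (leq_ltn_trans _ iN)// -ltnS.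
Qed.

(** The second factor is the derivative of ['X * (1 + u)], that is of [- log (1 - t)], hence the
    geometric series. *)
Lemma ell_log_deriv :
  (1 - 'X) * (1 + u + 'X * u^`()) =_(N.+1) 1.
Proof.
have h : 1 + u + 'X * u^`() =_(N.+1) \poly_(i < N.+1) (1 : C).
  move=> i iN; rewrite !coefD coef1 coefXM coef_deriv !coef_poly iN.
  case: i iN => [|i] iN /=; first by rewrite !addr0.
  by rewrite add0r iN -mulrS -[LHS]mulr_natr mulVf// pnatr_eq0.
apply: (eq_upto_trans (eq_uptoMl (1 - 'X) h)) => i iN.
rewrite mulrBl mul1r coefB coefXM coef1 !coef_poly iN.
by case: i iN => [|i] iN /=; rewrite ?subr0// ltnW ?subrr.
Qed.

Lemma deriv_one_sub_power y :
  (one_sub_power y)^`() =_(N) (- y) *: one_sub_power (y - 1).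
Proof.
move=> i iN; rewrite coef_deriv coefZ !coef_poly !ltnS iN (ltnW iN).
transitivity (- (-1) ^+ i * ((i.+1)%:R * binomC y i.+1)).
  by rewrite -[LHS]mulr_natr exprS; ring.
by rewrite binomC_absorb; ring.
Qed.

Lemma one_sub_power_mul y :
  (1 - 'X) * one_sub_power (y - 1) =_(N.+1) one_sub_power y.
Proof.
move=> i iN; rewrite mulrBl mul1r coefB coefXM !coef_poly iN.
case: i iN => [|i] iN /=; first by rewrite !binomC0 subr0.
by rewrite ltnW// (binomC_pascal y) exprS; ring.
Qed.

Lemma coef_one_sub_ell_step y r : (r < N)%N ->
  y * (one_sub_power (y - 1) * ell_power (- r.+1%:R))`_r =
  - r.+1%:R * (one_sub_power (y - 1) * ell_power (- r.+1%:R - 1))`_r.+1.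
Proof.
move=> rN; set c := - r.+1%:R; set F := one_sub_power y.
set F1 := one_sub_power _; set G := ell_power c; set G1 := ell_power _.
have rN1 : (r.+1 < N.+1)%N by [].
have E1 : (F^`() * G)`_r = - y * (F1 * G)`_r.
  by rewrite (eq_uptoMr G (deriv_one_sub_power y) rN) -scalerAl coefZ.
have E2 : (F * G^`())`_r = c * (F * G1 * ('X * u^`()))`_r.+1.
  rewrite (eq_uptoMl F (deriv_ell_power c) rN) -scalerAr coefZ.
  have -> : F * G1 * ('X * u^`()) = 'X * (F * (G1 * u^`())) by ring.
  by rewrite coefXM.
have E3 : (F * G)`_r.+1 = (F * G1 * (1 + u))`_r.+1.
  by rewrite -(eq_uptoMl F (ell_power_mul c) rN1) mulrCA mulrC.
have E4 : (F * G1 * (1 + u + 'X * u^`()))`_r.+1 = (F1 * G1)`_r.+1.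
  rewrite -mulrA -(eq_uptoMr _ (one_sub_power_mul y) rN1) -/F1.
  have -> : (1 - 'X) * F1 * (G1 * (1 + u + 'X * u^`())) =
    F1 * G1 * ((1 - 'X) * (1 + u + 'X * u^`())) by ring.
  by rewrite (eq_uptoMl (F1 * G1) ell_log_deriv rN1) mulr1.
have E5 : (F * G)^`()`_r = r.+1%:R * (F * G)`_r.+1.
  by rewrite coef_deriv mulr_natl.
rewrite -E4 [_ * (_ + 'X * _)]mulrDr coefD -E3.
move: E5; rewrite derivM coefD E1 E2 => E5.
by rewrite -[LHS]opprK -mulNr -[- y * _](addrK (c * (F * G1 * ('X * u^`()))`_r.+1))
  E5 /c; ring.
Qed.

(** Formally, the residue at 0 of [(1 - t)^(y-1) (- log (1 - t))^(-r-1) dt], which the substitution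
    [t = 1 - exp (- v)] turns into that of [exp (- y v) v^(-r-1) dv]. *)
Lemma coef_one_sub_ell y r : (r <= N)%N ->
  (one_sub_power (y - 1) * ell_power (- r.+1%:R))`_r = (- y) ^+ r / (r`!)%:R.
Proof.
elim: r => [_|r IH rN].
  rewrite coef0M coef_poly /= binomC0 !expr0 fact0 divr1 !mul1r.
  rewrite /ell_power coef_sum big_ord_recl big1 => [|j _].
    by rewrite coefZ coef1 binomC0 mulr1 addr0.
  by rewrite coefZ coef_exp_small ?lift0// mulr0.
have := coef_one_sub_ell_step y rN; rewrite IH ?(ltnW rN)//.
rewrite -opprD natr1 => E; have n0 : (r.+1)%:R != 0 :> C by rewrite pnatr_eq0.
have f0 : (r`!)%:R != 0 :> C by rewrite pnatr_eq0 -lt0n fact_gt0.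
have nn0 : - (r.+1)%:R != 0 :> C by rewrite oppr_eq0.
apply: (mulfI nn0); rewrite -E factS natrM exprS.
by field; rewrite f0 nat1r n0.
Qed.

End LogarithmSeries.

(** The coefficient of [coef_one_sub_ell] written as a convolution, with the signs [(-1) ^+ r] and
    [(-1) ^+ (r - k)] collected. It feeds [Q_diff]. *)
Lemma power_alpha_binom (R : realType) (y : R[i]) (r : nat) :
  y ^+ r = (r`!)%:R * \sum_(k < r.+1)
    (-1) ^+ k * alpha k (- r%:R) * binomC (y - 1) (r - k).
Proof.
have f0 : (r`!)%:R != 0 :> R[i] by rewrite pnatr_eq0 -lt0n fact_gt0.
have := @coef_one_sub_ell R r y r (leqnn r).
rewrite mulrC coefM exprNn -natr1 opprD => E.
have -> : y ^+ r = (r`!)%:R * ((-1) ^+ r * ((-1) ^+ r * y ^+ r / (r`!)%:R)).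
  have -> : (-1) ^+ r * ((-1) ^+ r * y ^+ r / (r`!)%:R) =
    ((-1) ^+ r * (-1) ^+ r) * (y ^+ r / (r`!)%:R) by ring.
  by rewrite -expr2 sqrr_sign mul1r mulrC divfK.
congr (_ * _); rewrite -E mulr_sumr; apply: eq_bigr => k _.
have kr : (k <= r)%N by rewrite -ltnS.
rewrite -(@alpha_ell_power _ r)// coef_poly ltnS leq_subr.
rewrite -[in (-1) ^+ r](subnK kr) exprD.
transitivity ((-1) ^+ (r - k) ^+ 2 *
  ((-1) ^+ k * alpha k (- r%:R) * binomC (y - 1) (r - k))).
  by ring.
by rewrite sqrr_sign mul1r.
Qed.

Local Open Scope classical_set_scope.
Local Open Scope complex_scope.

(** * Complex differentiability *)

Section ComplexNorm.
Variable R : realType.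
Local Notation C := R[i].
Implicit Types (z w : C) (x : R).

Lemma normc_normr z : (normc z)%:C = `|z|. Proof. by []. Qed.

Lemma normc_ge0 z : 0 <= normc z.
Proof. by case: z => a b; exact: sqrtr_ge0. Qed.

Lemma normc_le_add z w : normc (z + w) <= normc z + normc w.
Proof. exact: (@le_normcD R). Qed.

Lemma normc_opp z : normc (- z) = normc z.
Proof. exact: (@normcN R). Qed.

Lemma normc_le_sub z w : normc (z - w) <= normc z + normc w.
Proof. by rewrite -(normc_opp w) normc_le_add. Qed.

Lemma normc_distC z w : normc (z - w) = normc (w - z).
Proof. by rewrite -normc_opp opprB. Qed.

Lemma normc_real x : normc x%:C = `|x|.
Proof. by rewrite /normc /= expr0n /= addr0 sqrtr_sqr. Qed.

Lemma normc_nat n : normc (n%:R : C) = n%:R.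
Proof. by rewrite -(rmorph_nat (real_complex R)) normc_real normr_nat. Qed.

Lemma Re_le_normc z : `|complex.Re z| <= normc z.
Proof. by have := normc_ge_Re z; rewrite -normc_normr lecR. Qed.

Lemma Im_le_normc z : `|complex.Im z| <= normc z.
Proof.
by case: z => a b /=; rewrite -sqrtr_sqr ler_wsqrtr// lerDr sqr_ge0.
Qed.

Lemma normc_le_ReIm z : normc z <= `|complex.Re z| + `|complex.Im z|.
Proof.
have -> : z = (complex.Re z)%:C + (complex.Im z)%:C * 'i.
  by rewrite {1}[z]complexE [_ * 'i%C]mulrC.
apply: (le_trans (normc_le_add _ _)); rewrite normcM !normc_real.
by case: z => a b /=; simpc => /=; rewrite !expr0n expr1n add0r sqrtr1 mulr1.
Qed.

Lemma normc_sum (I : Type) (s : seq I) (P : pred I) (F : I -> C) :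
  normc (\sum_(i <- s | P i) F i) <= \sum_(i <- s | P i) normc (F i).
Proof.
elim/big_rec2: _ => [|i x y _ h]; first by rewrite normc0.
by apply: (le_trans (normc_le_add _ _)); rewrite lerD2l.
Qed.

End ComplexNorm.

Section ComplexDerivative.
Variable R : realType.
Local Notation C := R[i].

(** The little-o form of the derivative, with real bounds: no quotient at [h = 0], and estimates
    that stay in [R]. *)
Definition has_cderiv (f : C -> C) (z d : C) := forall e : R, 0 < e ->
  exists2 del : R, 0 < del &
  forall h, normc h < del -> normc (f (z + h) - f z - d * h) <= e * normc h.

Definition entire (f : C -> C) := forall z, derivable (f : C^o -> C^o) z 1.

Lemma derivable_has_cderiv (f : C -> C) z :
  derivable (f : C^o -> C^o) z 1 -> exists d, has_cderiv f z d.
Proof.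
move=> /cvg_ex[/= d hd]; exists d => e e0.
have ec0 : 0 < e%:C by rewrite ltcR.
move/cvgrPdist_le : hd => /(_ e%:C ec0).
rewrite near_withinE => /nbhs_ballP[del /= del0 H].
(* The radius is a positive element of [C], hence real, and its real part serves as radius. *)
exists (complex.Re del); first by move: del0; rewrite ltcE => /andP[].
move=> h hdel; have [->|h0] := eqVneq h 0.
  by rewrite addr0 subrr mulr0 subrr normc0 mulr0.
have := H h; rewrite /ball /= /ball_ /= sub0r normrN => /(_ _ h0).
have delE : (complex.Re del)%:C = del by rewrite RRe_real// gtr0_real.
rewrite -normc_normr -delE ltcR => /(_ hdel).
rewrite -normc_normr lecR => H'.
rewrite -normc_opp -[X in normc X](_ :
  h * (d - h^-1 *: (f (h%:A + z) - f z)) = _); last first.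
  rewrite /GRing.scale /= mulrBr mulrA divff// mul1r mulr1 [h + z]addrC; ring.
by rewrite normcM mulrC ler_wpM2r ?normc_ge0.
Qed.

Lemma has_cderiv_derivable (f : C -> C) z d :
  has_cderiv f z d -> derivable (f : C^o -> C^o) z 1.
Proof.
move=> hd; apply/cvg_ex; exists d => /=; apply/cvgrPdist_le => e e0.
have eE : (complex.Re e)%:C = e by rewrite RRe_real// gtr0_real.
have re0 : 0 < complex.Re e by rewrite -ltcR eE.
have [del del0 H] := hd _ re0.
rewrite near_withinE; apply/nbhs_ballP; exists del%:C; rewrite /= ?ltcR// => h.
rewrite /ball /= /ball_ /= sub0r normrN -normc_normr ltcR => hdel h0.
rewrite -normc_normr -eE lecR.
have hp : 0 < normc h.
  by rewrite lt_def normc_ge0 andbT; apply: contra h0 => /eqP/eq0_normc ->.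
rewrite -(ler_pM2r hp) -normcM -normc_opp.
rewrite [X in normc X](_ : _ = f (z + h) - f z - d * h) ?H//.
rewrite /GRing.scale /= mulr1 [h + z]addrC mulrC mulrBr mulrA divff// mul1r; ring.
Qed.

Lemma entireD f g : entire f -> entire g -> entire (fun z => f z + g z).
Proof. by move=> hf hg z; exact: (derivableD (hf z) (hg z)). Qed.

Lemma entireB f g : entire f -> entire g -> entire (fun z => f z - g z).
Proof. by move=> hf hg z; exact: (derivableB (hf z) (hg z)). Qed.

Lemma entireM f g : entire f -> entire g -> entire (fun z => f z * g z).
Proof. by move=> hf hg z; exact: (derivableM (hf z) (hg z)). Qed.

Lemma entire_cst a : entire (fun=> a).
Proof. by move=> z; exact: derivable_cst. Qed.

Lemma entire_id : entire id.
Proof. by move=> z; exact: derivable_id. Qed.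

Lemma entire_comp f g : entire f -> entire g -> entire (fun z => f (g z)).
Proof.
move=> hf hg z; apply/derivable1_diffP.
by apply: (@differentiable_comp _ _ _ _ (g : C^o -> C^o) (f : C^o -> C^o));
  apply/derivable1_diffP.
Qed.

End ComplexDerivative.

(** * Curves in the complex plane *)

Section Curves.
Variable R : realType.
Local Notation C := R[i].
Implicit Types (F G : R -> C) (x : R) (c d : C).

Lemma is_derive_eps (f : R -> R) (x d : R) : is_derive x 1 f d ->
  forall e : R, 0 < e -> exists2 del : R, 0 < del &
  forall h, `|h| < del -> `|f (x + h) - f x - d * h| <= e * `|h|.
Proof.
move=> [fx fd] e e0; move: fx; rewrite /derivable => fx.
have : h^-1 *: ((f \o shift x) (h *: 1) - f x) @[h --> 0^'] --> d.
  by rewrite -fd; exact: fx.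
move/cvgrPdist_le => /(_ e e0).
rewrite near_withinE => /nbhs_ballP[del /= del0 H].
exists del => // h hdel; have [->|h0] := eqVneq h 0.
  by rewrite addr0 subrr mulr0 subrr normr0 mulr0.
have := H h; rewrite /ball /= sub0r normrN => /(_ hdel h0) {}H.
rewrite -normrN -[X in `|X|](_ : h * (d - h^-1 *: (f (h%:A + x) - f x)) = _).
  by rewrite normrM mulrC ler_wpM2r.
by rewrite /GRing.scale /= mulrBr mulrA divff// mul1r mulr1 [h + x]addrC; ring.
Qed.

Lemma eps_is_derive (f : R -> R) (x d : R) :
  (forall e : R, 0 < e -> exists2 del : R, 0 < del &
    forall h, `|h| < del -> `|f (x + h) - f x - d * h| <= e * `|h|) ->
  is_derive x 1 f d.
Proof.
move=> hd; have cv : h^-1 *: ((f \o shift x) (h *: 1) - f x) @[h --> 0^'] --> d.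
  apply/cvgrPdist_le => e e0; have [del del0 H] := hd _ e0.
  rewrite near_withinE; apply/nbhs_ballP; exists del => //= h.
  rewrite /ball /= sub0r normrN => hdel h0.
  have hp : 0 < `|h| by rewrite normr_gt0.
  rewrite -(ler_pM2r hp) -normrM -normrN.
  rewrite [X in `|X|](_ : _ = f (x + h) - f x - d * h) ?H//.
  by rewrite /GRing.scale /= mulr1 [h + x]addrC mulrC mulrBr mulrA divff// mul1r; ring.
apply: DeriveDef; first by apply/cvg_ex; exists d.
by apply/cvg_lim.
Qed.

Definition curve_deriv F x d := forall e : R, 0 < e ->
  exists2 del : R, 0 < del &
  forall h : R, `|h| < del -> normc (F (x + h) - F x - d * h%:C) <= e * `|h|.

Lemma Re_subc (z w : C) : complex.Re (z - w) = complex.Re z - complex.Re w.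
Proof. by case: z; case: w. Qed.

Lemma Im_subc (z w : C) : complex.Im (z - w) = complex.Im z - complex.Im w.
Proof. by case: z; case: w. Qed.

Lemma Re_mul_real (z : C) (t : R) : complex.Re (z * t%:C) = complex.Re z * t.
Proof. by case: z => a b; simpc. Qed.

Lemma Im_mul_real (z : C) (t : R) : complex.Im (z * t%:C) = complex.Im z * t.
Proof. by case: z => a b; simpc. Qed.

Lemma curve_deriv_Re F x d : curve_deriv F x d ->
  is_derive x 1 (fun t => complex.Re (F t)) (complex.Re d).
Proof.
move=> hd; apply: eps_is_derive => e /hd[del del0 H]; exists del => // h /H.
by apply: le_trans; rewrite -Re_mul_real -!Re_subc Re_le_normc.
Qed.

Lemma curve_deriv_Im F x d : curve_deriv F x d ->
  is_derive x 1 (fun t => complex.Im (F t)) (complex.Im d).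
Proof.
move=> hd; apply: eps_is_derive => e /hd[del del0 H]; exists del => // h /H.
by apply: le_trans; rewrite -Im_mul_real -!Im_subc Im_le_normc.
Qed.

Lemma curve_deriv_ReIm F x d :
  is_derive x 1 (fun t => complex.Re (F t)) (complex.Re d) ->
  is_derive x 1 (fun t => complex.Im (F t)) (complex.Im d) ->
  curve_deriv F x d.
Proof.
move=> /is_derive_eps h1 /is_derive_eps h2 e e0.
have e20 : 0 < e / 2 by rewrite divr_gt0.
have [d1 d10 H1] := h1 _ e20; have [d2 d20 H2] := h2 _ e20.
exists (Num.min d1 d2); first by rewrite lt_min d10.
move=> h; rewrite lt_min => /andP[/H1 {}H1 /H2 {}H2].
apply: (le_trans (normc_le_ReIm _)); rewrite !Re_subc !Im_subc Re_mul_real Im_mul_real.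
by rewrite (splitr e) mulrDl lerD.
Qed.

Lemma curve_deriv_real (f : R -> R) (x d : R) :
  is_derive x 1 f d -> curve_deriv (fun t => (f t)%:C) x d%:C.
Proof.
move=> fd; apply: curve_deriv_ReIm => //=.
exact: is_derive_cst.
Qed.

Lemma curve_derivD F G x c d : curve_deriv F x c -> curve_deriv G x d ->
  curve_deriv (fun t => F t + G t) x (c + d).
Proof.
move=> h1 h2 e e0; have e20 : 0 < e / 2 by rewrite divr_gt0.
have [d1 d10 H1] := h1 _ e20; have [d2 d20 H2] := h2 _ e20.
exists (Num.min d1 d2); first by rewrite lt_min d10.
move=> h; rewrite lt_min => /andP[/H1 {}H1 /H2 {}H2].
rewrite (_ : _ - _ = (F (x + h) - F x - c * h%:C) +
  (G (x + h) - G x - d * h%:C)); last by ring.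
by apply: (le_trans (normc_le_add _ _)); rewrite (splitr e) mulrDl lerD.
Qed.

Lemma curve_deriv_comp (f : C -> C) F x c d : has_cderiv f (F x) c ->
  curve_deriv F x d -> curve_deriv (fun t => f (F t)) x (c * d).
Proof.
(* [K] bounds the difference quotients of [F] near [x], thanks to the [1] in the minimum [e2]. Half
   of [e] pays for the error of [f], half for [c] times the error of [F]. *)
move=> hf hF e e0; pose K := normc d + 1.
have K0 : 0 < K by rewrite ltr_wpDl ?normc_ge0.
have L0 : 0 < normc c + 1 by rewrite ltr_wpDl ?normc_ge0.
have e1 : 0 < e / 2 / K by rewrite !divr_gt0.
have [d1 d10 H1] := hf _ e1.
have e2 : 0 < Num.min 1 (e / 2 / (normc c + 1)) by rewrite lt_min !divr_gt0 ?ltr01.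
have [d2 d20 H2] := hF _ e2.
exists (Num.min d2 (d1 / K)); first by rewrite lt_min d20 divr_gt0.
move=> h; rewrite lt_min => /andP[/H2 {}H2]; rewrite ltr_pdivlMr// => hK.
pose k := F (x + h) - F x.
have kE : normc (k - d * h%:C) <= `|h| * Num.min 1 (e / 2 / (normc c + 1)).
  by rewrite [leRHS]mulrC.
have k1 : normc k <= `|h| * K.
  rewrite -[k](subrK (d * h%:C)); apply: (le_trans (normc_le_add _ _)).
  rewrite normcM normc_real /K mulrDr mulr1 addrC [normc d * _]mulrC lerD2l.
  by rewrite (le_trans kE)// ler_piMr// ge_min lexx.
have kE2 : normc c * normc (k - d * h%:C) <= `|h| * (e / 2).
  apply: (@le_trans _ _ (normc c * (`|h| * (e / 2 / (normc c + 1))))).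
    rewrite ler_wpM2l ?normc_ge0// (le_trans kE)// ler_wpM2l//.
    by rewrite ge_min lexx orbT.
  rewrite mulrCA ler_wpM2l// mulrCA ler_piMr//; first by rewrite ltW// divr_gt0.
  by rewrite ler_pdivrMr// mul1r lerDl.
rewrite (_ : _ - _ = (f (F x + k) - f (F x) - c * k) + c * (k - d * h%:C)); last first.
  by rewrite [F x + k]addrC subrK /k; ring.
apply: (le_trans (normc_le_add _ _)); rewrite normcM.
rewrite (splitr e) mulrDl lerD//; last by rewrite [leRHS]mulrC.
apply: (le_trans (H1 _ _)); first by rewrite (le_lt_trans k1).
apply: (@le_trans _ _ (e / 2 / K * (`|h| * K))).
  by rewrite ler_wpM2l// ltW.
by rewrite mulrCA divfK ?gt_eqF// mulrC.
Qed.

Lemma has_cderiv_scale (a z : C) : has_cderiv ( *%R a) z a.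
Proof.
move=> e e0; exists 1 => // h _; rewrite (_ : _ - _ = 0) ?normc0; last by ring.
by rewrite mulr_ge0 ?normc_ge0 ?ltW.
Qed.

Lemma curve_derivZ F x (a : C) d : curve_deriv F x d ->
  curve_deriv (fun t => a * F t) x (a * d).
Proof. exact/curve_deriv_comp/has_cderiv_scale. Qed.

Lemma curve_deriv_cst c x : curve_deriv (fun=> c) x 0.
Proof. by apply: curve_deriv_ReIm; exact: is_derive_cst. Qed.

Lemma curve_deriv_line (z : C) d x : curve_deriv (fun t => z + d * t%:C) x d.
Proof.
rewrite -[X in curve_deriv _ _ X]add0r; apply: curve_derivD.
  exact: curve_deriv_cst.
rewrite -[X in curve_deriv _ _ X]mulr1; apply: curve_derivZ.
by apply: curve_deriv_real; exact: is_derive_id.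
Qed.

(* The factor 2 comes from applying the mean value theorem separately to the
   real and imaginary parts. *)
Lemma curve_mean_value F (g : R -> C) a b M : a <= b ->
  (forall x, a <= x <= b -> curve_deriv F x (g x)) ->
  (forall x, a <= x <= b -> normc (g x) <= M) ->
  normc (F b - F a) <= 2 * M * (b - a).
Proof.
move=> ab hF hM; apply: (le_trans (normc_le_ReIm _)).
have main (p : C -> R) : {morph p : z w / z - w} ->
    (forall z, `|p z| <= normc z) ->
    (forall x d, curve_deriv F x d -> is_derive x 1 (fun t => p (F t)) (p d)) ->
    `|p (F b - F a)| <= M * (b - a).
  move=> pB pn pd; rewrite pB.
  have [|||c cab ->] := @MVT_segment R (fun t => p (F t)) (fun t => p (g t)) a b.
  - exact: ab.
  - by move=> x; rewrite in_itv/= => /andP[ax xb]; apply/pd/hF; rewrite !ltW.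
  - apply: derivable_within_continuous => x; rewrite in_itv/= => xab.
    by have [] := pd x _ (hF x xab).
  rewrite normrM (ger0_norm (_ : 0 <= b - a)) ?subr_ge0//.
  by rewrite ler_wpM2r ?subr_ge0// (le_trans (pn _))// hM// -in_itv.
have -> : 2 * M * (b - a) = M * (b - a) + M * (b - a) by ring.
apply: lerD; apply: main.
- exact: Re_subc.
- exact: Re_le_normc.
- by move=> x d; exact: curve_deriv_Re.
- exact: Im_subc.
- exact: Im_le_normc.
- by move=> x d; exact: curve_deriv_Im.
Qed.

End Curves.

(** * The complex exponential and its derivative *)

Section ComplexExponential.
Variable R : realType.
Local Notation C := R[i].
Implicit Types (z w : C).

Definition cexp z : C :=
  (expR (complex.Re z) * cos (complex.Im z)) +i*
  (expR (complex.Re z) * sin (complex.Im z)).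

Lemma cexp0 : cexp 0 = 1.
Proof. by rewrite /cexp /= expR0 cos0 sin0 mulr1 mulr0. Qed.

Lemma cexpD z w : cexp (z + w) = cexp z * cexp w.
Proof.
case: z => a b; case: w => c d; rewrite /cexp /=; simpc.
rewrite expRD cosD sinD; apply/eqP; rewrite eq_complex /=; apply/andP.
by split; apply/eqP; ring.
Qed.

Lemma normc_cexp z : normc (cexp z) = expR (complex.Re z).
Proof.
case: z => a b; rewrite /cexp /= !exprMn -mulrDr cos2Dsin2 mulr1.
by rewrite sqrtr_sqr ger0_norm ?expR_ge0.
Qed.

Lemma cexp_real (x : R) : cexp x%:C = (expR x)%:C.
Proof. by rewrite /cexp /= cos0 sin0 mulr1 mulr0. Qed.

Lemma cexp_period z : cexp (z + 'i * (2 * pi)%:C) = cexp z.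
Proof.
have -> : (2 * pi : R)  = pi *+ 2 by rewrite mulr_natl.
by case: z => a b; rewrite /cexp; simpc => /=; rewrite cosD2pi sinD2pi.
Qed.

Lemma has_cderiv_cexp0 : has_cderiv cexp 0 1.
Proof.
(* The error splits into the terms [A1] to [A5] below, of weights 1, 2, 1, 2, 1 in [eps * n]; their
   sum is 7. The bound [eps <= 1] controls the factors [1 + a] and [sin b]. *)
move=> e e0; have [eps [eps0 eps1 eps7]] : exists eps : R,
    [/\ 0 < eps, eps <= 1 & eps <= e / 7].
  exists (Num.min 1 (e / 7)); rewrite lt_min ltr01 divr_gt0// !ge_min !lexx.
  by rewrite orbT.
have [d1 d10 H1] := is_derive_eps (is_derive_expR (0 : R)) eps0.
have [d2 d20 H2] := is_derive_eps (is_derive_cos (0 : R)) eps0.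
have [d3 d30 H3] := is_derive_eps (is_derive_sin (0 : R)) eps0.
exists (Num.min (Num.min d1 d2) (Num.min d3 eps)).
  by rewrite !lt_min d10 d20 d30.
case=> a b; rewrite add0r cexp0 mul1r.
have ah : `|a| <= _ := Re_le_normc (a +i* b).
have bh : `|b| <= _ := Im_le_normc (a +i* b).
have := normc_ge0 (a +i* b).
move: (normc (a +i* b)) ah bh => n ah bh n0.
rewrite !lt_min => /andP[/andP[n1 n2] /andP[n3 n4]].
have {H1} := H1 a (le_lt_trans ah n1); have {H2} := H2 b (le_lt_trans bh n2).
have {H3} := H3 b (le_lt_trans bh n3).
rewrite !add0r expR0 cos0 sin0 oppr0 mul0r !oppr0 !addr0 !mul1r => H3 H2 H1.
have cb : `|cos b| <= 1 by rewrite ler_norml cos_geN1 cos_le1.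
have sb : `|sin b| <= 1 by rewrite ler_norml sin_geN1 sin_le1.
have sb2 : `|sin b| <= 2 * `|b|.
  have -> : sin b = (sin b - b) + b by ring.
  apply: (le_trans (ler_normD _ _)).
  by have := normr_ge0 b; nra.
have a0 := normr_ge0 a; have b0 := normr_ge0 b.
apply: (le_trans (normc_le_ReIm _)); rewrite !Re_subc !Im_subc /= oppr0 addr0.
have -> : expR a * cos b - 1 - a =
  (expR a - 1 - a) * cos b + (1 + a) * (cos b - 1) by ring.
have -> : expR a * sin b - b =
  (expR a - 1 - a) * sin b + a * sin b + (sin b - b) by ring.
have A1 : `|(expR a - 1 - a) * cos b| <= eps * n.
  by rewrite normrM; have := normr_ge0 (expR a - 1 - a); nra.
have A2 : `|(1 + a) * (cos b - 1)| <= 2 * eps * n.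
  rewrite normrM; have := normr_ge0 (cos b - 1).
  have : `|1 + a| <= 2 by apply: (le_trans (ler_normD _ _)); rewrite normr1; lra.
  nra.
have A3 : `|(expR a - 1 - a) * sin b| <= eps * n.
  by rewrite normrM; have := normr_ge0 (expR a - 1 - a); nra.
have A4 : `|a * sin b| <= 2 * eps * n by rewrite normrM; nra.
have A5 : `|sin b - b| <= eps * n by nra.
have := ler_normD ((expR a - 1 - a) * cos b) ((1 + a) * (cos b - 1)).
have := ler_normD ((expR a - 1 - a) * sin b + a * sin b) (sin b - b).
have := ler_normD ((expR a - 1 - a) * sin b) (a * sin b).
have : 7 * eps * n <= e * n by rewrite ler_wpM2r//; lra.
lra.
Qed.

Lemma has_cderiv_cexp z : has_cderiv cexp z (cexp z).
Proof.
move=> e e0; have n0 : 0 < normc (cexp z) by rewrite normc_cexp expR_gt0.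
have [|del del0 H] := @has_cderiv_cexp0 (e / normc (cexp z)).
  by rewrite divr_gt0.
exists del => // h /H; rewrite add0r cexp0 mul1r => {}H.
rewrite (_ : _ - _ = cexp z * (cexp h - 1 - h)); last by rewrite cexpD; ring.
rewrite normcM; apply: (le_trans (ler_wpM2l (normc_ge0 _) H)).
by rewrite mulrA mulrCA divff ?gt_eqF// mulr1.
Qed.

Lemma entire_cexp : entire cexp.
Proof. by move=> z; exact: has_cderiv_derivable (has_cderiv_cexp z). Qed.

End ComplexExponential.

(** * Primitives and integrals of complex-valued functions of a real variable *)

Section CurveIntegral.
Variable R : realType.
Local Notation C := R[i].
Implicit Types (F G g : R -> C) (x : R).

(** The integral from a base point is a primitive only to the right of that point. The base point
    therefore moves with [x], and subtracting the value at 0 makes the result independent of it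
    ([FE]). *)
Lemma continuous_primitive (g : R -> R) : continuous g ->
  exists F : R -> R, forall x, is_derive x 1 F (g x).
Proof.
move=> gc; pose I a x := \int[@lebesgue_measure R]_(t in `[a, x]) g t.
have gi a b : (@lebesgue_measure R).-integrable `[a, b] (EFin \o g).
  apply: continuous_compact_integrable; first exact: segment_compact.
  exact: continuous_subspaceT.
have Iadd a b c : a <= b -> b <= c -> I a c = I a b + I b c.
  move=> ab bc.
  have := @Rintegral_itvB R g (BLeft a) (BRight c) b (gi a c).
  rewrite !bnd_simp => /(_ ab bc); rewrite Rintegral_itv_obnd_cbnd => [E|].
    by rewrite {3}/I -E addrC subrK.
  by apply: integrableS (gi b c) => //; apply: subset_itvr; rewrite bnd_simp.
pose F x := I (- (`|x| + 1)) x - I (- (`|x| + 1)) 0.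
have FE A x : `|x| + 1 <= A -> F x = I (- A) x - I (- A) 0.
  move=> xA; rewrite /F.
  have xn := ler_norm (- x); rewrite normrN in xn; have x0 := normr_ge0 x.
  rewrite (Iadd (- A) (- (`|x| + 1)) x); [|lra|lra].
  by rewrite (Iadd (- A) (- (`|x| + 1)) 0); [ring|lra|lra].
(* The margin 2 gives [|y| + 1 <= A] for every [y] within distance 1 of [x], so one base point
   serves a whole neighbourhood. *)
exists F => x; pose A := `|x| + 2.
apply: (@near_eq_is_derive _ _ _ (fun y => I (- A) y - I (- A) 0)).
  near=> y; rewrite -FE// /A.
  have : `|x - y| < 1 by near: y; apply: nbhsx_ballx.
  have := ler_norm (y - x); have := ler_normD x (y - x); rewrite addrCA subrr addr0.
  by rewrite [`|y - x|]distrC; lra.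
rewrite -[g x]subr0; apply: is_deriveB.
have [||||dI IE] := @continuous_FTC1_closed R g (- A) x (x + 1).
- by rewrite ltrDl.
- exact: gi.
- have := ler_norm (- x); rewrite normrN /A; have := normr_ge0 x; lra.
- exact: gc.
by apply: DeriveDef; [exact: dI|rewrite -derive1E; exact: IE].
Unshelve. all: by end_near. Qed.

Definition differentiable_curve g := forall x, exists d, curve_deriv g x d.

(** A primitive obtained by choice, with the zero function as default; [cprimP] shows that the
    default does not occur for differentiable [g]. *)
Definition cprim g : R -> C :=
  xget (fun=> 0) [set F | forall x, curve_deriv F x (g x)].

Lemma cprimP g : differentiable_curve g ->
  forall x, curve_deriv (cprim g) x (g x).
Proof.
move=> gd; rewrite /cprim; case: xgetP => [F -> //|].
have [|F1 H1] := @continuous_primitive (fun x => complex.Re (g x)).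
  move=> x; have [d /curve_deriv_Re[df _]] := gd x.
  exact/differentiable_continuous/derivable1_diffP.
have [|F2 H2] := @continuous_primitive (fun x => complex.Im (g x)).
  move=> x; have [d /curve_deriv_Im[df _]] := gd x.
  exact/differentiable_continuous/derivable1_diffP.
move=> /(_ (fun x => F1 x +i* F2 x)) /=; case=> x.
exact: curve_deriv_ReIm.
Qed.

(** The integral as increment of a primitive, which makes additivity in the end points an algebraic
    identity. *)
Definition cint g a b := cprim g b - cprim g a.

Lemma cintD g a b c : cint g a b + cint g b c = cint g a c.
Proof. by rewrite /cint; ring. Qed.

(** The difference of two primitives has derivative 0, so the mean value bound with [M = 0] makes
    its increment vanish. *)
Lemma cint_primitive g F a b : a <= b ->
  (forall x, curve_deriv F x (g x)) -> differentiable_curve g ->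
  cint g a b = F b - F a.
Proof.
move=> ab hF hg; apply/eqP; rewrite -subr_eq0; apply/eqP/eq0_normc.
apply: le_anti; rewrite normc_ge0 andbT.
have := @curve_mean_value R (fun x => cprim g x + (-1) * F x) (fun=> 0) a b 0 ab.
rewrite mulr0 mul0r => h; apply: le_trans (h _ _).
- by rewrite /cint (_ : _ - _ = cprim g b + -1 * F b - (cprim g a + -1 * F a))//; ring.
- move=> x _; rewrite (_ : 0 = g x + (-1) * g x); last by ring.
  by apply: curve_derivD; [exact: cprimP|exact: curve_derivZ].
- by move=> x _; rewrite normc0.
Qed.

Lemma cintB f g a b : a <= b ->
  differentiable_curve f -> differentiable_curve g ->
  cint (fun x => f x - g x) a b = cint f a b - cint g a b.
Proof.
move=> ab hf hg.
have E : (fun x => f x - g x) = (fun x => f x + (-1) * g x).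
  by apply/funext => x; ring.
rewrite E (@cint_primitive _ (fun x => cprim f x + (-1) * cprim g x))//.
- by rewrite /cint; ring.
- by move=> x; apply: curve_derivD; [|apply: curve_derivZ]; exact: cprimP.
- move=> x; have [c hc] := hf x; have [d hd] := hg x; exists (c + (-1) * d).
  by apply: curve_derivD; [|apply: curve_derivZ].
Qed.

Lemma normc_cint g a b M : a <= b -> differentiable_curve g ->
  (forall x, a <= x <= b -> normc (g x) <= M) ->
  normc (cint g a b) <= 2 * M * (b - a).
Proof.
by move=> ab hg; apply: curve_mean_value => // x _; exact: cprimP.
Qed.

End CurveIntegral.

(** * Goursat's theorem *)

Lemma nested_intervals (R : realType) (a b : nat -> R) :
  (forall n, a n <= a n.+1) -> (forall n, b n.+1 <= b n) ->
  (forall n, a n <= b n) -> exists x, forall n, a n <= x <= b n.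
Proof.
move=> ai bd ab.
have ai2 m n : (m <= n)%N -> a m <= a n.
  by move=> /subnK <-; elim: (n - m)%N => // k IH; rewrite addSn (le_trans IH).
have bd2 m n : (m <= n)%N -> b n <= b m.
  move=> /subnK <-; elim: (n - m)%N => // k IH.
  by rewrite addSn (le_trans _ IH).
have abmn m n : a m <= b n.
  have [mn|/ltnW nm] := leqP m n; first by rewrite (le_trans (ai2 _ _ mn)).
  by rewrite (le_trans (ab m))// bd2.
have ubn n : ubound (range a) (b n) by move=> _ [m _ <-].
exists (sup (range a)) => n; apply/andP; split.
  by apply: ub_le_sup; [exists (b 0%N)|exists n].
by apply: ge_sup => //; exists (a 0%N), 0%N.
Qed.

Section Goursat.
Variable R : realType.
Local Notation C := R[i].
Implicit Types (h f : C -> C) (x y : R).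

Definition xycoord x y : C := x%:C + 'i * y%:C.

(** The contour integral along the boundary, counterclockwise from the lower left corner; ['i] is
    the derivative of the vertical parametrisation. *)
Definition rect_integral h x1 x2 y1 y2 : C :=
  cint (fun t => h (xycoord t y1)) x1 x2 + 'i * cint (fun t => h (xycoord x2 t)) y1 y2
  - cint (fun t => h (xycoord t y2)) x1 x2 - 'i * cint (fun t => h (xycoord x1 t)) y1 y2.

Lemma curve_deriv_horizontal y x : curve_deriv (fun t => xycoord t y) x 1.
Proof.
rewrite -[X in curve_deriv _ _ X]addr0; apply: curve_derivD.
  by apply: curve_deriv_real; exact: is_derive_id.
exact: curve_deriv_cst.
Qed.

Lemma curve_deriv_vertical x y : curve_deriv (fun t => xycoord x t) y 'i.
Proof. exact: curve_deriv_line. Qed.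

Lemma entire_horizontal h y : entire h ->
  differentiable_curve (fun t => h (xycoord t y)).
Proof.
move=> hh x; have [d hd] := derivable_has_cderiv (hh (xycoord x y)); exists (d * 1).
exact: (@curve_deriv_comp _ _ (fun t => xycoord t y)) (curve_deriv_horizontal _ _).
Qed.

Lemma entire_vertical h x : entire h ->
  differentiable_curve (fun t => h (xycoord x t)).
Proof.
move=> hh y; have [d hd] := derivable_has_cderiv (hh (xycoord x y)); exists (d * 'i).
exact: (@curve_deriv_comp _ _ (fun t => xycoord x t)) (curve_deriv_vertical _ _).
Qed.

Lemma rect_integral_splitx h x1 x2 x3 y1 y2 :
  rect_integral h x1 x3 y1 y2 =
  rect_integral h x1 x2 y1 y2 + rect_integral h x2 x3 y1 y2.
Proof. by rewrite /rect_integral -!(cintD _ x1 x2 x3); ring. Qed.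

Lemma rect_integral_splity h x1 x2 y1 y2 y3 :
  rect_integral h x1 x2 y1 y3 =
  rect_integral h x1 x2 y1 y2 + rect_integral h x1 x2 y2 y3.
Proof. by rewrite /rect_integral -!(cintD _ y1 y2 y3); ring. Qed.

Lemma rect_integralB h f x1 x2 y1 y2 : x1 <= x2 -> y1 <= y2 ->
  entire h -> entire f ->
  rect_integral (fun z => h z - f z) x1 x2 y1 y2 =
  rect_integral h x1 x2 y1 y2 - rect_integral f x1 x2 y1 y2.
Proof.
move=> x12 y12 hh hf; rewrite /rect_integral.
by rewrite !cintB//; do ?[exact: entire_horizontal|exact: entire_vertical]; ring.
Qed.

Lemma rect_integral_primitive h (P : C -> C) x1 x2 y1 y2 :
  x1 <= x2 -> y1 <= y2 -> entire h ->
  (forall z, has_cderiv P z (h z)) -> rect_integral h x1 x2 y1 y2 = 0.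
Proof.
move=> x12 y12 hh hP.
have H y : cint (fun t => h (xycoord t y)) x1 x2 = P (xycoord x2 y) - P (xycoord x1 y).
  apply: (cint_primitive (F := fun t => P (xycoord t y))) => //.
    move=> x; rewrite -[X in curve_deriv _ _ X]mulr1.
    exact: (@curve_deriv_comp _ _ (fun t => xycoord t y)) (curve_deriv_horizontal _ _).
  exact: entire_horizontal.
have ii : 'i * 'i = -1 :> C by rewrite -expr2 sqr_i.
have V x : 'i * cint (fun t => h (xycoord x t)) y1 y2 =
    P (xycoord x y2) - P (xycoord x y1).
  (* Along a vertical side [P] has derivative [h * 'i], so the factor [- 'i] yields a primitive of
     [h]. *)
  rewrite (cint_primitive (F := fun t => - 'i * P (xycoord x t)))//.
  - rewrite !mulNr opprK -mulrN -mulrDr mulrA ii; ring.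
  - move=> y; rewrite (_ : h _ = - 'i * (h (xycoord x y) * 'i)); last first.
      by rewrite mulrCA mulNr ii opprK mulr1.
    apply: curve_derivZ.
    exact: (@curve_deriv_comp _ _ (fun t => xycoord x t)) (curve_deriv_vertical _ _).
  - exact: entire_vertical.
by rewrite /rect_integral !H !V; ring.
Qed.

Lemma normc_i : normc ('i : C) = 1.
Proof. by rewrite /normc /= expr0n expr1n add0r sqrtr1. Qed.

Lemma normc_rect_integral h x1 x2 y1 y2 M : x1 <= x2 -> y1 <= y2 -> entire h ->
  (forall x y, x1 <= x <= x2 -> y1 <= y <= y2 -> normc (h (xycoord x y)) <= M) ->
  normc (rect_integral h x1 x2 y1 y2) <= 4 * M * ((x2 - x1) + (y2 - y1)).
Proof.
move=> x12 y12 hh hM.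
have H y : y1 <= y <= y2 ->
    normc (cint (fun t => h (xycoord t y)) x1 x2) <= 2 * M * (x2 - x1).
  by move=> yy; apply: normc_cint => //; [exact: entire_horizontal|move=> x xx; exact: hM].
have V x : x1 <= x <= x2 ->
    normc ('i * cint (fun t => h (xycoord x t)) y1 y2) <= 2 * M * (y2 - y1).
  rewrite normcM normc_i mul1r => xx.
  by apply: normc_cint => //; [exact: entire_vertical|move=> y yy; exact: hM].
have := H y1; have := H y2; have := V x1; have := V x2.
rewrite !lexx x12 y12 /= => /(_ isT) V2 /(_ isT) V1 /(_ isT) H2 /(_ isT) H1.
rewrite /rect_integral.
set A1 := cint _ _ _ in H1 *; set A2 := 'i * _ in V2 *.
set A3 := cint _ _ _ in H2 *; set A4 := 'i * _ in V1 *.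
have := normc_le_sub (A1 + A2 - A3) A4; have := normc_le_sub (A1 + A2) A3.
have := normc_le_add A1 A2; lra.
Qed.

Lemma normc_xycoordB x y a b :
  normc (xycoord x y - xycoord a b) <= `|x - a| + `|y - b|.
Proof.
apply: (le_trans (normc_le_ReIm _)); rewrite /xycoord; simpc => /=.
by rewrite lexx.
Qed.

(** A primitive of the affine function [a + b * z], whose rectangle integrals therefore vanish. The
    remainder is [b / 2 * h * h]. *)
Lemma has_cderiv_quadratic (a b z : C) :
  has_cderiv (fun w => a * w + b / 2 * w ^+ 2) z (a + b * z).
Proof.
move=> e e0; have b0 : 0 < normc b + 1 by rewrite ltr_wpDl ?normc_ge0.
exists (e / (normc b + 1)) => [|h]; first by rewrite divr_gt0.
rewrite ltr_pdivlMr// => hb.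
rewrite (_ : _ - _ = b / 2 * h * h); last by field.
rewrite !normcM normcV normc_nat ler_wpM2r ?normc_ge0//.
have := normc_ge0 b; have := normc_ge0 h; nra.
Qed.

Section Bisection.
Variables (h : C -> C) (hh : entire h).
(** A rectangle is the quadruple [(x1, x2, y1, y2)], with components [p.1.1.1], [p.1.1.2], [p.1.2]
    and [p.2]. *)
Let J (p : R * R * R * R) := rect_integral h p.1.1.1 p.1.1.2 p.1.2 p.2.

Let half (p p' : R * R * R * R) :=
  [/\ p.1.1.1 <= p'.1.1.1, p'.1.1.2 <= p.1.1.2,
      p.1.2 <= p'.1.2 & p'.2 <= p.2] /\
  [/\ p'.1.1.2 - p'.1.1.1 = (p.1.1.2 - p.1.1.1) / 2,
      p'.2 - p'.1.2 = (p.2 - p.1.2) / 2 &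
      normc (J p) <= 4 * normc (J p')].

(** The four quarters have integrals adding up to [J p]; if each had norm below a quarter of
    [normc (J p)], the triangle inequality would fail. *)
Let half_exists p : p.1.1.1 <= p.1.1.2 -> p.1.2 <= p.2 -> exists p', half p p'.
Proof.
case: p => [[[x1 x2] y1] y2] /= x12 y12.
pose xm := (x1 + x2) / 2; pose ym := (y1 + y2) / 2.
pose p1 := (x1, xm, y1, ym); pose p2 := (xm, x2, y1, ym).
pose p3 := (x1, xm, ym, y2); pose p4 := (xm, x2, ym, y2).
have JE : J (x1, x2, y1, y2) = J p1 + J p2 + (J p3 + J p4).
  by rewrite /J /= (rect_integral_splity _ x1 x2 y1 ym y2)
    (rect_integral_splitx _ x1 xm x2 y1 ym) (rect_integral_splitx _ x1 xm x2 ym y2).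
have : normc (J (x1, x2, y1, y2)) <=
    normc (J p1) + normc (J p2) + (normc (J p3) + normc (J p4)).
  rewrite JE (le_trans (normc_le_add _ _))// lerD// normc_le_add//.
move=> JL; suff: exists2 p', p' \in [:: p1; p2; p3; p4] &
    normc (J (x1, x2, y1, y2)) <= 4 * normc (J p').
  have [m1 m2] : xm - x1 = (x2 - x1) / 2 /\ x2 - xm = (x2 - x1) / 2.
    by rewrite /xm; split; field.
  have [n1 n2] : ym - y1 = (y2 - y1) / 2 /\ y2 - ym = (y2 - y1) / 2.
    by rewrite /ym; split; field.
  have [l1 l2] : x1 <= xm /\ xm <= x2.
    by split; rewrite -subr_ge0 ?m1 ?m2 divr_ge0 ?subr_ge0.
  have [l3 l4] : y1 <= ym /\ ym <= y2.
    by split; rewrite -subr_ge0 ?n1 ?n2 divr_ge0 ?subr_ge0.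
  move=> [p' + Jp']; rewrite !inE => /or4P[] /eqP pE; exists p'; move: Jp';
  by rewrite pE.
apply: contrapT => H.
have G p' : p' \in [:: p1; p2; p3; p4] -> 4 * normc (J p') < normc (J (x1, x2, y1, y2)).
  by move=> pin; rewrite ltNge; apply/negP => ?; apply: H; exists p'.
have := G p1; have := G p2; have := G p3; have := G p4.
rewrite !inE !eqxx /= !orbT => /(_ isT) ? /(_ isT) ? /(_ isT) ? /(_ isT) ?.
lra.
Qed.

(** Bisected rectangles shrink to a point near which [h] is affine up to an error small against the
    distance. The affine part integrates to 0, and the rest is small against [(D / 2 ^+ n) ^+ 2],
    which offsets the factor [4 ^+ n]. *)
Lemma Goursat x1 x2 y1 y2 : x1 <= x2 -> y1 <= y2 ->
  rect_integral h x1 x2 y1 y2 = 0.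
Proof.
move=> x12 y12; pose step p := xget p [set p' | half p p'].
pose p n := iter n step (x1, x2, y1, y2).
have pinv n : [/\ (p n).1.1.2 - (p n).1.1.1 = (x2 - x1) / 2 ^+ n,
    (p n).2 - (p n).1.2 = (y2 - y1) / 2 ^+ n &
    normc (rect_integral h x1 x2 y1 y2) <= 4 ^+ n * normc (J (p n))] /\
    half (p n) (p n.+1).
  have stepP q : q.1.1.1 <= q.1.1.2 -> q.1.2 <= q.2 -> half q (step q).
    move=> q1 q2; rewrite /step; case: xgetP => [q' -> //|].
    by have [q' hq'] := half_exists q1 q2 => /(_ q').
  elim: n => [|n [[E1 E2 E3] H]].
    by split; [split; rewrite ?expr0 ?divr1 ?mul1r | exact: stepP].
  have := H; move=> [_ [D1 D2 D3]].
  have S : [/\ (p n.+1).1.1.2 - (p n.+1).1.1.1 = (x2 - x1) / 2 ^+ n.+1,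
    (p n.+1).2 - (p n.+1).1.2 = (y2 - y1) / 2 ^+ n.+1 &
    normc (rect_integral h x1 x2 y1 y2) <= 4 ^+ n.+1 * normc (J (p n.+1))].
    rewrite D1 D2 E1 E2 exprSr invfM !mulrA; split => //.
    by rewrite (le_trans E3)// exprSr -mulrA ler_wpM2l// exprn_ge0.
  have w0 : 0 < (2 ^+ n.+1)^-1 :> R by rewrite invr_gt0 exprn_gt0.
  have [S1 S2 _] := S; split => //.
  apply: stepP; rewrite -subr_ge0 ?S1 ?S2 mulr_ge0 ?subr_ge0// ltW//.
have pw n : 0 < (2 ^+ n)^-1 :> R by rewrite invr_gt0 exprn_gt0.
have px n : (p n).1.1.1 <= (p n).1.1.2.
  by rewrite -subr_ge0; have [[-> _ _] _] := pinv n; rewrite mulr_ge0 ?subr_ge0// ltW.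
have py n : (p n).1.2 <= (p n).2.
  by rewrite -subr_ge0; have [[_ -> _] _] := pinv n; rewrite mulr_ge0 ?subr_ge0// ltW.
have [x0 hx0] : exists x, forall n, (p n).1.1.1 <= x <= (p n).1.1.2.
  by apply: nested_intervals => // n; have [_ [[]]] := pinv n.
have [y0 hy0] : exists y, forall n, (p n).1.2 <= y <= (p n).2.
  by apply: nested_intervals => // n; have [_ [[]]] := pinv n.
have /derivable_has_cderiv[d hd] := @hh (xycoord x0 y0).
pose D := (x2 - x1) + (y2 - y1).
have D0 : 0 <= D by rewrite addr_ge0 ?subr_ge0.
apply: eq0_normc; apply: le_anti; rewrite normc_ge0 andbT.
apply/ler_addgt0Pr => e e0; rewrite add0r.
(* The final estimate is [4 * D ^+ 2] times this quantity; the summand 1 keeps the denominator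
   positive when [D = 0]. *)
have e1 : 0 < e / (4 * D ^+ 2 + 1) by rewrite divr_gt0// ltr_wpDl// mulr_ge0// sqr_ge0.
have [del del0 Hdel] := hd _ e1.
have [n Dn] : exists n, D / 2 ^+ n < del.
  exists (Num.bound (D / del)); rewrite ltr_pdivrMr ?exprn_gt0// mulrC.
  rewrite -ltr_pdivrMr// (lt_trans (archi_boundP _)) ?divr_ge0// ?(ltW del0)//.
  by rewrite -natrX ltr_nat ltn_expl.
pose a := h (xycoord x0 y0) - d * xycoord x0 y0.
have affE : entire (fun z => a + d * z).
  apply: entireD; first exact: entire_cst.
  by apply: entireM; [exact: entire_cst|exact: entire_id].
have [[E1 E2 E3] _] := pinv n; move: E1 E2 E3 (px n) (py n) (hx0 n) (hy0 n).
clear px py hx0 hy0 pinv; move: (p n) => -[[[u1 u2] v1] v2]; rewrite /J /=.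
move=> E1 E2 E3 u12 v12 /andP[x0a x0b] /andP[y0a y0b]; apply: (le_trans E3).
have JE : rect_integral h u1 u2 v1 v2 =
    rect_integral (fun z => h z - (a + d * z)) u1 u2 v1 v2.
  rewrite rect_integralB//.
  by rewrite (rect_integral_primitive u12 v12 affE (has_cderiv_quadratic a d)) subr0.
have DE : D / 2 ^+ n = (u2 - u1) + (v2 - v1) by rewrite E1 E2 -mulrDl.
have Jb : normc (rect_integral h u1 u2 v1 v2) <=
    4 * (e / (4 * D ^+ 2 + 1) * (D / 2 ^+ n)) * (D / 2 ^+ n).
  rewrite JE [X in _ <= _ * X]DE.
  apply: (normc_rect_integral u12 v12 (entireB hh affE)).
  move=> x y /andP[xa xb] /andP[ya yb]; pose k := xycoord x y - xycoord x0 y0.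
  have kb : normc k <= D / 2 ^+ n.
    apply: (le_trans (normc_xycoordB _ _ _ _)); rewrite DE.
    by apply: lerD; rewrite ler_norml; lra.
  rewrite (_ : _ - _ = h (xycoord x0 y0 + k) - h (xycoord x0 y0) - d * k); last first.
    by rewrite [_ + k]addrC subrK /a /k; ring.
  apply: (le_trans (Hdel _ (le_lt_trans kb Dn))).
  by rewrite ler_wpM2l// ltW.
apply: (le_trans (ler_wpM2l _ Jb)); first by rewrite exprn_ge0.
have -> : 4 ^+ n = (2 ^+ n) ^+ 2 :> R by rewrite -exprM mulnC exprM; congr (_ ^+ n); ring.
have t0 : 2 ^+ n != 0 :> R by rewrite expf_neq0.
have s0 : 4 * D ^+ 2 + 1 != 0 by rewrite gt_eqF// ltr_wpDl// mulr_ge0// sqr_ge0.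
rewrite [leLHS](_ : _ = e * (4 * D ^+ 2 / (4 * D ^+ 2 + 1))); last first.
  by field; rewrite t0 s0.
rewrite ler_piMr// ?ltW// ltr_pdivrMr ?ltr_wpDl// ?mulr_ge0 ?sqr_ge0// mul1r.
by rewrite ltrDl.
Qed.

End Bisection.
End Goursat.

(** * Mean values and continuation *)

Section MeanValue.
Variable R : realType.
Local Notation C := R[i].

Lemma entire_eps (G : C -> C) s : entire G -> forall e : R, 0 < e ->
  exists2 del : R, 0 < del &
  forall w, normc w < del -> normc (G (s + w) - G s) <= e.
Proof.
move=> hG e e0; have /derivable_has_cderiv[d hd] := hG s.
have [del del0 H] := hd 1 ltr01; have K0 : 0 < 1 + normc d.
  by rewrite ltr_pwDl ?normc_ge0.
exists (Num.min del (e / (1 + normc d))); first by rewrite lt_min del0 divr_gt0.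
move=> w; rewrite lt_min ltr_pdivlMr// => /andP[/H {}H we].
rewrite -[X in normc X](subrK (d * w)); apply: (le_trans (normc_le_add _ _)).
rewrite normcM; nra.
Qed.

Lemma differentiable_curve_bounded (g : R -> C) a b : a <= b ->
  differentiable_curve g ->
  exists M, forall x, a <= x <= b -> normc (g x) <= M.
Proof.
move=> ab hg.
have main (p : C -> R) : (forall x d, curve_deriv g x d ->
      is_derive x 1 (fun t => p (g t)) (p d)) ->
    exists M, forall x, a <= x <= b -> `|p (g x)| <= M.
  move=> hp; have pc : {within `[a, b], continuous (fun t => `|p (g t)|)}.
    apply: continuous_subspaceT => x.
    apply: (@continuous_comp _ _ _ (fun t => p (g t)) Num.norm).
      have [d /hp[df _]] := hg x.
      exact/differentiable_continuous/derivable1_diffP.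
    exact: norm_continuous.
  have [c _ H] := EVT_max ab pc; exists `|p (g c)| => x xab.
  by apply: H; rewrite in_itv.
have [M1 H1] := main _ (fun x d => @curve_deriv_Re R g x d).
have [M2 H2] := main _ (fun x d => @curve_deriv_Im R g x d).
exists (M1 + M2) => x xab; apply: (le_trans (normc_le_ReIm _)).
by rewrite lerD ?H1 ?H2.
Qed.

Lemma xycoord0 (y : R) : xycoord 0 y = 'i * y%:C.
Proof. by rewrite /xycoord add0r. Qed.

Lemma Re_xycoord (x y : R) : complex.Re (xycoord x y) = x.
Proof. by rewrite /xycoord; simpc. Qed.

Lemma entire_exp_polar (G : C -> C) s : entire G ->
  entire (fun z => G (s + cexp z)).
Proof.
move=> hG; apply: (entire_comp hG).
by apply: entireD; [exact: entire_cst|exact: entire_cexp].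
Qed.

(* Goursat for [G (s + exp z)] on [[x, 0] x [0, 2 pi]]: the horizontal sides
   cancel by periodicity, so the mean of [G] over the circle of radius
   [exp x] does not depend on [x]; let [x] tend to [-oo]. *)
Lemma center_bound (G : C -> C) (s : C) (M : R) : entire G ->
  (forall y : R, 0 <= y <= 2 * pi -> normc (G (s + cexp ('i * y%:C))) <= M) ->
  normc (G s) <= 2 * M.
Proof.
move=> hG hM; have pi0 : 0 < 2 * pi :> R by rewrite mulr_gt0// pi_gt0.
have hh := @entire_exp_polar G s hG.
apply/ler_addgt0Pr => e e0; have e20 : 0 < e / 2 by rewrite divr_gt0.
have [del del0 H] := entire_eps s hG e20.
(* This makes the circle radius [expR x] smaller than [del], while [x <= 0] is the order that
   [Goursat] asks for. *)
pose x := Num.min 0 (ln (del / 2)).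
have x0 : x <= 0 by rewrite ge_min lexx.
have xdel : expR x < del.
  apply: (@le_lt_trans _ _ (del / 2)); last by rewrite ltr_pdivrMr// ltr_pMr// ltr1n.
  rewrite -[leRHS](@lnK R) ?posrE ?divr_gt0// ler_expR.
  by rewrite ge_min lexx orbT.
have := Goursat hh x0 (ltW pi0); rewrite /rect_integral.
have -> : (fun t => G (s + cexp (xycoord t (2 * pi)))) =
          (fun t => G (s + cexp (xycoord t 0))).
  apply/funext => t; congr (G (s + _)).
  by rewrite /xycoord cexp_period mulr0 addr0.
move: (2 * pi) pi0 hM => T T0 hM.
set A := cint _ x 0; set B0 := cint _ 0 _; set B1 := cint _ 0 _ => E.
have {E} E : B0 = B1.
  have i0 : 'i != 0 :> C by rewrite eq_complex /= oner_eq0 andbF.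
  move: A B0 B1 E => A B0 B1 E; apply: (mulfI i0).
  have -> : 'i * B0 = (A + 'i * B0 - A - 'i * B1) + 'i * B1 by ring.
  by rewrite E add0r.
have B0b : normc B0 <= 2 * M * T.
  rewrite -[X in _ <= _ * X]subr0; apply: normc_cint; first exact: ltW.
    exact: (@entire_vertical R _ 0 hh).
  by move=> y hy; rewrite xycoord0 hM.
have cE : cint (fun=> G s) 0 T = G s * T%:C.
  rewrite (cint_primitive (F := fun t => 0 + G s * t%:C) (ltW T0)).
  - by rewrite !add0r rmorph0 mulr0 subr0.
  - by move=> t; exact: curve_deriv_line.
  - by move=> t; exists 0; exact: curve_deriv_cst.
have Db : normc (B1 - G s * T%:C) <= 2 * (e / 2) * T.
  have hc : differentiable_curve (fun=> G s).
    by move=> t; exists 0; exact: curve_deriv_cst.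
  have hv := @entire_vertical R _ x hh.
  rewrite -cE -cintB ?(ltW T0)// -[X in _ <= _ * X]subr0.
  apply: normc_cint; first exact: ltW.
    move=> t; have [d hd] := hv t; exists (d + 0); apply: curve_derivD => //.
    exact: curve_deriv_cst.
  by move=> y _; apply: H; rewrite normc_cexp Re_xycoord.
have : normc (G s * T%:C) <= normc B1 + normc (B1 - G s * T%:C).
  rewrite -[X in normc X <= _](_ : B1 - (B1 - G s * T%:C) = _); last by ring.
  exact: normc_le_sub.
rewrite -E normcM normc_real ger0_norm ?(ltW T0)// E => h.
rewrite -(ler_pM2r T0); move: h B0b Db; rewrite E; lra.
Qed.

End MeanValue.

(** * Propagation of convergence from a right half-plane to the left *)

Section Continuation.
Variable R : realType.
Local Notation C := R[i].
Implicit Types (f : C -> C) (G : nat -> C -> C) (s w : C).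

Definition cseq_cvg (u : nat -> C) (l : C) := forall e : R, 0 < e ->
  exists n0, forall n, (n0 <= n)%N -> normc (u n - l) <= e.

(** Uniform over the closed unit disc about [s], which contains the circle used by
    [center_bound]. *)
Definition cauchy_near G s := forall e : R, 0 < e ->
  exists n0, forall m n, (n0 <= m)%N -> (n0 <= n)%N ->
  forall w, normc w <= 1 -> normc (G m (s + w) - G n (s + w)) <= e.

Lemma cvg_cseq_cvg (u : nat -> C) l :
  (u : nat -> C^o) @ \oo --> (l : C^o) -> cseq_cvg u l.
Proof.
move=> /cvgrPdist_le h e e0; have ec0 : 0 < e%:C by rewrite ltcR.
have [n0 _ H] := h _ ec0; exists n0 => n nn0.
by have := H n nn0; rewrite /= -normc_normr lecR normc_distC.
Qed.

Lemma normc_unit (y : R) : normc (cexp ('i * y%:C)) = 1.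
Proof. by rewrite normc_cexp -xycoord0 Re_xycoord expR0. Qed.

Lemma Re_unit_weight w (y : R) : w = cexp ('i * y%:C) ->
  complex.Re (w + w ^+ 2 / 2) = cos y + cos y ^+ 2 - 1 / 2 /\
  complex.Re w = cos y.
Proof.
have -> : cexp ('i * y%:C) = cos y +i* sin y.
  by rewrite /cexp -xycoord0 Re_xycoord expR0 !mul1r /xycoord; simpc.
have half : (2 : C)^-1 = (2^-1 : R)%:C by rewrite fmorphV rmorph_nat.
move=> ->; split => //; rewrite half expr2; simpc => /=.
have := cos2Dsin2 y; move: (cos y) (sin y) => c d E.
have -> : d * d = 1 - c ^+ 2 by rewrite -E; ring.
by field.
Qed.

(* Applies [center_bound] to [(f - G n) exp (lam (w + w^2/2))]: on the unit
   circle [Re (w + w^2/2) = c + c^2 - 1/2] with [c = Re w], which is at most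
   [-3/16] where [c <= 1/4], so a large [lam] absorbs the part of the circle
   on which the convergence is not yet known. *)
Lemma continuation_step f G s : entire f -> (forall n, entire (G n)) ->
  cauchy_near G s ->
  (forall w, 1 / 4 <= complex.Re w ->
     cseq_cvg (fun n => G n (s + w)) (f (s + w))) ->
  cseq_cvg (fun n => G n s) (f s).
Proof.
move=> hf hG hC hr e e0.
have pi0 : 0 <= 2 * pi :> R by rewrite mulr_ge0// ltW// pi_gt0.
have bd (H : C -> C) : entire H -> exists M, forall y : R, 0 <= y <= 2 * pi ->
    normc (H (s + cexp ('i * y%:C))) <= M.
  move=> hH; apply: differentiable_curve_bounded => // y.
  have [d hd] := @entire_vertical R _ 0 (@entire_exp_polar R H s hH) y.
  by exists d; move: hd; under eq_fun do rewrite xycoord0.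
have [N1 HN1] := hC 1 ltr01.
have [Mf HMf] := bd _ hf; have [MG HMG] := bd _ (hG N1).
(* A bound for [f - G n] on the circle, uniform in [n >= N1]: the 1 is the Cauchy distance from
   [G n] to [G N1]. Thus [lam] can be fixed before [n]. *)
pose M := `|Mf| + `|MG| + 1.
have M0 : 0 < M by rewrite ltr_wpDl// addr_ge0.
have HM n y : (N1 <= n)%N -> 0 <= y <= 2 * pi ->
    normc (f (s + cexp ('i * y%:C)) - G n (s + cexp ('i * y%:C))) <= M.
  move=> nN y0; set z := s + _.
  have -> : f z - G n z = f z - G N1 z - (G n z - G N1 z) by ring.
  apply: (le_trans (normc_le_sub _ _)); apply: lerD.
    apply: (le_trans (normc_le_sub _ _)).
    apply: lerD; [apply: (le_trans (HMf y y0))|apply: (le_trans (HMG y y0))];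
      exact: ler_norm.
  by apply: HN1; rewrite ?normc_unit.
pose lam := 16 / 3 * `|ln (e / 2 / M)|.
have lam0 : 0 <= lam by rewrite mulr_ge0.
have lamE : M * expR (lam * (- 3 / 16)) <= e / 2.
  rewrite mulrC -ler_pdivlMr// -[leRHS](@lnK R) ?posrE ?divr_gt0// ler_expR.
  rewrite /lam; have := ler_norm (- ln (e / 2 / M)); rewrite normrN; lra.
(* On the right part of the circle the weight is at most [expR (lam * 2)], since
   [c + c^2 - 1/2 <= 3/2] for [c <= 1]. *)
pose eta := e / 2 * expR (- (lam * 2)).
have eta0 : 0 < eta by rewrite mulr_gt0 ?expR_gt0 ?divr_gt0.
have eta20 : 0 < eta / 2 by rewrite divr_gt0.
have [N2 HN2] := hC _ eta20.
exists (maxn N1 N2) => n; rewrite geq_max => /andP[nN1 nN2].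
(* Pointwise convergence becomes uniform: the auxiliary index [m] depends on [w], but the Cauchy
   bound [N2] does not. *)
have hrn w : normc w <= 1 -> 1 / 4 <= complex.Re w ->
    normc (f (s + w) - G n (s + w)) <= eta.
  move=> w1 rw; have [N3 HN3] := hr w rw _ eta20.
  pose m := maxn N2 N3.
  have -> : f (s + w) - G n (s + w) =
      G m (s + w) - G n (s + w) - (G m (s + w) - f (s + w)) by ring.
  apply: (le_trans (normc_le_sub _ _)); rewrite (splitr eta); apply: lerD.
    by apply: HN2 => //; rewrite leq_maxl.
  by apply: HN3; rewrite leq_maxr.
have hzs : entire (fun z : C => z - s) := entireB (@entire_id R) (@entire_cst R s).
pose W z := lam%:C * ((z - s) + (z - s) * (z - s) * 2^-1).
have hW : entire W.
  exact: entireM (@entire_cst R lam%:C)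
    (entireD hzs (entireM (entireM hzs hzs) (@entire_cst R 2^-1))).
pose H z := (f z - G n z) * cexp (W z).
have hH : entire H.
  exact: entireM (entireB hf (hG n)) (entire_comp (@entire_cexp R) hW).
have -> : normc (G n s - f s) = normc (H s).
  by rewrite /H /W subrr !mul0r addr0 mulr0 cexp0 mulr1 normc_distC.
rewrite [leRHS](_ : e = 2 * (e / 2)); last by field.
apply: center_bound => // y y0.
rewrite /H /W [s + cexp _ - s]addrAC subrr add0r -expr2 normcM normc_cexp.
have [] := Re_unit_weight (erefl (cexp ('i * y%:C))).
set w := cexp _ => W1 W2.
have -> : complex.Re (lam%:C * (w + w ^+ 2 / 2)) =
    lam * (cos y + cos y ^+ 2 - 1 / 2) by rewrite [RHS]mulrC -W1 -Re_mul_real mulrC.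
have [cy|cy] := leP (1 / 4) (cos y).
  have c1 : cos y <= 1 by exact: cos_le1.
  apply: (@le_trans _ _ (eta * expR (lam * 2))); last first.
    by rewrite /eta -mulrA -expRD addNr expR0 mulr1.
  apply: ler_pM; rewrite ?normc_ge0 ?expR_ge0//.
    by apply: hrn; rewrite ?W2 ?normc_unit.
  by rewrite ler_expR ler_wpM2l//; nra.
apply: (le_trans _ lamE); apply: ler_pM; rewrite ?normc_ge0 ?expR_ge0//.
  exact: HM.
have c1 : -1 <= cos y by exact: cos_geN1.
by rewrite ler_expR ler_wpM2l//; nra.
Qed.

Lemma continuation f G (a : R) : entire f -> (forall n, entire (G n)) ->
  (forall s, a <= complex.Re s -> cauchy_near G s) ->
  (forall s, 1 < complex.Re s -> cseq_cvg (fun n => G n s) (f s)) ->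
  forall s, a <= complex.Re s -> cseq_cvg (fun n => G n s) (f s).
Proof.
move=> hf hG hC h1.
(* Each application of [continuation_step] moves the frontier [1 - k / 4] to the left by 1/4. *)
have main (k : nat) s : a <= complex.Re s -> 1 - k%:R / 4 < complex.Re s ->
    cseq_cvg (fun n => G n s) (f s).
  elim: k s => [|k IH] s sa; first by rewrite mul0r subr0; exact: h1.
  rewrite -natr1 => sk; apply: continuation_step => // [|w hw]; first exact: hC.
  have ReD : complex.Re (s + w) = complex.Re s + complex.Re w.
    by case: (s); case: (w).
  by apply: IH; rewrite ReD; lra.
move=> s sa; pose k := Num.bound (4 * (`|complex.Re s| + 1)).
apply: (main k) => //.
have : 4 * (`|complex.Re s| + 1) < k%:R.
  by apply: archi_boundP; rewrite mulr_ge0// addr_ge0.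
have := ler_norm (- complex.Re s); rewrite normrN; lra.
Qed.

End Continuation.

(** * Averaging of partial sums *)

Section Averaging.
Variable R : realType.
Local Notation C := R[i].
Variables (q : nat) (q0 : (0 < q)%N).
Implicit Types (A B P phi : nat -> C).

Definition avg A : nat -> C := fun n => (\sum_(a < q) A (n + a)%N) / q%:R.

Let qC0 : q%:R != 0 :> C. Proof. by rewrite pnatr_eq0 -lt0n. Qed.

(** Averages look only forward, so formulas valid from a positive index on can be substituted. *)
Lemma iter_avg_ext j A B n : (forall m, (n <= m)%N -> A m = B m) ->
  iter j avg A n = iter j avg B n.
Proof.
elim: j n => [|j IH] n h /=; first exact: h.
rewrite /avg; congr (_ / _); apply: eq_bigr => a _; apply: IH => m hm.
by apply: h; rewrite (leq_trans _ hm)// leq_addr.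
Qed.

Lemma iter_avg_sum j (I : Type) (s : seq I) (F : I -> nat -> C) n :
  iter j avg (fun m => \sum_(i <- s) F i m) n = \sum_(i <- s) iter j avg (F i) n.
Proof.
elim: j n => [//|j IH] n /=; rewrite /avg -mulr_suml; congr (_ / _).
by rewrite exchange_big; apply: eq_bigr => a _; rewrite IH.
Qed.

Lemma iter_avgZ j c A n : iter j avg (fun m => c * A m) n = c * iter j avg A n.
Proof.
elim: j n => [//|j IH] n /=; rewrite /avg mulrA mulr_sumr.
by congr (_ / _); apply: eq_bigr => a _; rewrite IH.
Qed.

Lemma iter_avgB j A B n :
  iter j avg (fun m => A m - B m) n = iter j avg A n - iter j avg B n.
Proof.
elim: j n => [//|j IH] n /=; rewrite /avg -mulrBl -sumrB.
by congr (_ / _); apply: eq_bigr => a _; rewrite IH.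
Qed.

Lemma iter_avg_shift j A n : iter j avg (fun m => A m.+1) n = iter j avg A n.+1.
Proof.
elim: j n => [//|j IH] n /=; rewrite /avg.
by congr (_ / _); apply: eq_bigr => a _; rewrite IH addSn.
Qed.

Lemma iter_avg_cst j c n : iter j avg (fun=> c) n = c.
Proof.
elim: j n => [//|j IH] n /=; rewrite /avg.
under eq_bigr do rewrite IH.
by rewrite sumr_const card_ord -[c *+ q]mulr_natr mulfK.
Qed.

Lemma normc_avg A n b : (forall a, (a < q)%N -> normc (A (n + a)%N) <= b) ->
  normc (avg A n) <= b.
Proof.
move=> h; rewrite /avg normcM normcV normc_nat ler_pdivrMr ?ltr0n//.
apply: (le_trans (normc_sum _ _ _)).
have -> : b * q%:R = \sum_(a < q) b by rewrite sumr_const card_ord mulr_natr.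
by apply: ler_sum => a _; exact: h.
Qed.

Lemma iter_avg_cvg j A l : cseq_cvg A l -> cseq_cvg (iter j avg A) l.
Proof.
move=> h; elim: j => // j IH e e0 /=; have [n0 H] := IH e e0.
exists n0 => n nn0; rewrite -[in X in _ - X](iter_avg_cst 1 l n) /=.
rewrite -[X in normc X](iter_avgB 1 (iter j avg A) (fun=> l)) /=.
by apply: normc_avg => a _; apply: H; rewrite (leq_trans nn0)// leq_addr.
Qed.

Lemma entire_sum (I : Type) (s : seq I) (F : I -> C -> C) :
  (forall i, entire (F i)) -> entire (fun z => \sum_(i <- s) F i z).
Proof.
move=> hF; elim: s => [|i s IH].
  by under eq_fun do rewrite big_nil; exact: (@entire_cst R 0).
under eq_fun do rewrite big_cons.
exact: entireD (hF i) IH.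
Qed.

Lemma entire_iter_avg j (A : C -> nat -> C) : (forall n, entire (A^~ n)) ->
  forall n, entire (fun s => iter j avg (A s) n).
Proof.
move=> hA; elim: j => [//|j IH] n /=.
rewrite /avg; apply: (entireM (g := fun=> q%:R^-1)); last exact: entire_cst.
by apply: entire_sum => a; exact: IH.
Qed.

(** Iterated forward differences, with the steps listed in [l]; the last entry is applied first. *)
Definition diffs (l : seq nat) phi : nat -> C :=
  foldr (fun a f n => f (n + a)%N - f n) phi l.

Lemma diffs_sum l (I : Type) (s : seq I) (F : I -> nat -> C) n :
  diffs l (fun m => \sum_(i <- s) F i m) n = \sum_(i <- s) diffs l (F i) n.
Proof. by elim: l n => [//|a l IH] n /=; rewrite !IH sumrB. Qed.

Lemma diffsZ l c phi n : diffs l (fun m => c * phi m) n = c * diffs l phi n.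
Proof. by elim: l n => [//|a l IH] n /=; rewrite !IH mulrBr. Qed.

Lemma diffs_ext l phi psi n : (forall m, phi m = psi m) ->
  diffs l phi n = diffs l psi n.
Proof. by move=> /funext ->. Qed.

(** A forward difference lowers the degree: the innermost one turns [m ^+ k] into a combination of
    lower powers, each killed by the remaining steps. *)
Lemma diffs_monomial l k n : (k < size l)%N ->
  diffs l (fun m => m%:R ^+ k) n = 0.
Proof.
elim/last_ind: l k n => // l a IH k n; rewrite size_rcons ltnS => kl.
rewrite /diffs foldr_rcons -/(diffs _ _).
rewrite (@diffs_ext _ _ (fun m => \sum_(i <- index_enum 'I_k)
    (a%:R ^+ (k - i) *+ 'C(k, i)) * m%:R ^+ i)); last first.
  move=> m; rewrite natrD [m%:R + _]addrC exprDn big_ord_recr /= subnn expr0 mul1r.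
  by rewrite binn mulr1n addrK; apply: eq_bigr => i _; rewrite mulrnAl.
rewrite diffs_sum big1 // => i _; rewrite diffsZ IH ?mulr0//.
exact: leq_trans (ltn_ord i) kl.
Qed.

(* Each averaging of [P phi] trades [phi] for its differences, because the
   mean of [P] over any [q] consecutive integers vanishes. *)
Lemma normc_iter_avg_mean_zero j P phi n (K b : R) :
  (forall m, \sum_(a < q) P (m + a)%N = 0) -> (forall m, normc (P m) <= K) ->
  (forall l, size l = j -> all (ltn^~ q) l -> normc (diffs l phi n) <= b) ->
  normc (iter j avg (fun m => P m * phi m) n) <= K * b.
Proof.
elim: j P phi => [|j IH] P phi P0 PK hb /=.
  rewrite normcM; apply: ler_pM; rewrite ?normc_ge0//.
  exact: (hb [::]).
rewrite -iterS iterSr.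
have -> : avg (fun m => P m * phi m) = fun m => \sum_(a <- index_enum 'I_q)
    (q%:R^-1 * (P (m + a)%N * (phi (m + a)%N - phi m))).
  apply/funext => m; rewrite /avg mulrC mulr_sumr.
  under [RHS]eq_bigr do rewrite mulrBr mulrBr.
  rewrite sumrB [X in _ = _ - X](_ : _ = 0) ?subr0//.
  by rewrite -mulr_sumr -mulr_suml P0 mul0r mulr0.
rewrite iter_avg_sum.
under eq_bigr do rewrite iter_avgZ.
(* The sum over shifts [a] is itself read as an average, in the variable [a] and evaluated at 0, so
   that [normc_avg] applies. *)
rewrite -mulr_sumr mulrC -[X in normc X]/(avg (fun a => iter j avg
  (fun m => P (m + a)%N * (phi (m + a)%N - phi m)) n) 0).
apply: normc_avg => a aq; rewrite add0n.
apply: (IH (fun m => P (m + a)%N) (fun m => phi (m + a)%N - phi m)) => //.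
  by move=> m; under eq_bigr do rewrite addnAC; exact: P0.
move=> l lj la; have := hb (rcons l a); rewrite /diffs foldr_rcons; apply.
  by rewrite size_rcons lj.
by rewrite all_rcons /= aq.
Qed.

(** The bound [normc_iter_avg_mean_zero] with [b = 0]: differences of order [j] kill polynomials of
    degree below [j]. *)
Lemma iter_avg_mean_zero_poly j P (p : {poly C}) (K : R) n :
  (forall m, \sum_(a < q) P (m + a)%N = 0) -> (forall m, normc (P m) <= K) ->
  (size p <= j)%N -> iter j avg (fun m => P m * p.[m%:R]) n = 0.
Proof.
move=> P0 PK pj; apply: eq0_normc; apply: le_anti; rewrite normc_ge0 andbT.
rewrite -(mulr0 K).
apply: normc_iter_avg_mean_zero => // l lj _.
rewrite (@diffs_ext _ _ (fun m => \sum_(i <- index_enum 'I_(size p))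
    p`_i * m%:R ^+ i)); last first.
  by move=> m; rewrite horner_coef.
rewrite diffs_sum big1 ?normc0// => i _; rewrite diffsZ diffs_monomial ?mulr0//.
by rewrite lj (leq_trans (ltn_ord i)).
Qed.

End Averaging.

(** * Decay of the differences of complex powers of a real variable *)

Section RealPowers.
Variable R : realType.
Local Notation C := R[i].
Implicit Types (s : C) (x : R).

(** The power [x^(-s)] for [x > 0]; note the sign of the exponent. *)
Definition rpow s x : C := cexp (- s * (ln x)%:C).

Lemma npow_neg_rpow n s : npow_neg n s = rpow s n%:R.
Proof.
case: s => a b; rewrite /rpow /npow_neg /cexp; simpc => /=.
by rewrite cosN sinN mulrN.
Qed.

Lemma entire_rpow x : entire (fun s => rpow s x).
Proof.
have hN : entire (fun s : C => - s).
  by under eq_fun do rewrite -sub0r; exact: entireB (@entire_cst R 0) (@entire_id R).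
exact: entire_comp (@entire_cexp R) (entireM hN (@entire_cst R (ln x)%:C)).
Qed.

Lemma rpow_nat (r : nat) x : 0 < x -> rpow (- r%:R) x = x%:C ^+ r.
Proof.
move=> x0; rewrite /rpow opprK -(rmorph_nat (real_complex R)) -rmorphM /=.
by rewrite cexp_real expRM_natl lnK ?posrE// rmorphXn.
Qed.

Lemma normc_rpow s x : 0 < x -> normc (rpow s x) = expR (- complex.Re s * ln x).
Proof. by move=> x0; rewrite normc_cexp Re_mul_real; case: s. Qed.

Lemma curve_deriv_rpow s x : 0 < x ->
  curve_deriv (rpow s) x (- s * rpow (s + 1) x).
Proof.
move=> x0; have -> : - s * rpow (s + 1) x =
    cexp (- s * (ln x)%:C) * (- s * (x^-1)%:C).
  rewrite /rpow opprD mulrDl cexpD mulN1r -(rmorphN (real_complex R)).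
  by rewrite cexp_real expRN lnK ?posrE//; ring.
apply: (@curve_deriv_comp R (@cexp R) (fun t => - s * (ln t)%:C)).
  exact: has_cderiv_cexp.
by apply: curve_derivZ; apply: curve_deriv_real; exact: is_derive1_ln.
Qed.

(** The counterpart of [diffs] on a real variable, where differences can be estimated by
    derivatives. *)
Definition rdiffs (l : seq nat) (f : R -> C) : R -> C :=
  foldr (fun a g x => g (x + a%:R) - g x) f l.

Lemma diffs_rdiffs l (f : R -> C) n :
  diffs l (fun m => f m%:R) n = rdiffs l f n%:R.
Proof. by elim: l n => [//|a l IH] n /=; rewrite !IH natrD. Qed.

Lemma curve_deriv_shift (f : R -> C) x a d :
  curve_deriv f (x + a) d -> curve_deriv (fun t => f (t + a)) x d.
Proof.
move=> hf e e0; have [del del0 H] := hf e e0; exists del => // h hdel.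
by rewrite [x + h + a]addrAC; exact: H.
Qed.

Lemma curve_deriv_rdiffs l s x : 0 < x ->
  curve_deriv (rdiffs l (rpow s)) x (- s * rdiffs l (rpow (s + 1)) x).
Proof.
elim: l x => [|a l IH] x x0 /=; first exact: curve_deriv_rpow.
have xa0 : 0 < x + a%:R by rewrite ltr_wpDr.
rewrite (_ : - s * _ = - s * rdiffs l (rpow (s + 1)) (x + a%:R) +
  (-1) * (- s * rdiffs l (rpow (s + 1)) x)); last by ring.
have -> : (fun t => rdiffs l (rpow s) (t + a%:R) - rdiffs l (rpow s) t) =
    (fun t => rdiffs l (rpow s) (t + a%:R) + (-1) * rdiffs l (rpow s) t).
  by apply/funext => t; ring.
apply: curve_derivD; first by apply: curve_deriv_shift; exact: IH.
by apply: curve_derivZ; exact: IH.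
Qed.

(** By the mean value bound each difference, of step below [q], costs a factor [2 * q * normc s] and
    replaces [s] by [s + 1]. After all steps the real part is at least 2, whence the decay
    [x^(-2)]. *)
Lemma normc_rdiffs_rpow (q : nat) l s x : 1 <= x -> all (ltn^~ q) l ->
  2 <= complex.Re s + (size l)%:R ->
  normc (rdiffs l (rpow s) x) <=
  (2 * q%:R * (normc s + (size l)%:R)) ^+ size l * (x ^+ 2)^-1.
Proof.
elim: l s x => [|a l IH] s x x1.
  move=> _; rewrite [size _]/= addr0 => s2.
  have x0 : 0 < x by rewrite (lt_le_trans ltr01).
  rewrite [rdiffs _ _]/(rpow s) expr0 mul1r normc_rpow//.
  rewrite -[X in _ <= X^-1](@lnK R) ?posrE ?exprn_gt0//.
  rewrite -expRN ler_expR lnXn// -mulr_natl mulNr lerN2 ler_wpM2r//.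
  exact: ln_ge0.
rewrite /= => /andP[aq lq] sl; have xa : x <= x + a%:R by rewrite lerDl.
pose B := (2 * q%:R * (normc s + (size l).+1%:R)) ^+ size l * (x ^+ 2)^-1.
(* The quantity [normc s + size l] does not grow along the induction, so one base serves for all
   factors. *)
have n1 : normc (s + 1) + (size l)%:R <= normc s + (size l).+1%:R.
  by rewrite -natr1; have := normc_le_add s 1; rewrite normc1; lra.
have hB t : x <= t <= x + a%:R ->
    normc (- s * rdiffs l (rpow (s + 1)) t) <= normc s * B.
  move=> /andP[xt _]; have t1 := le_trans x1 xt.
  rewrite normcM normc_opp ler_wpM2l ?normc_ge0//.
  have Re1 : complex.Re (s + 1) = complex.Re s + 1 by case: (s).
  apply: (le_trans (IH (s + 1) t t1 lq _)).
    by rewrite Re1 -addrA [1 + _]addrC natr1.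
  have x0 : 0 < x by rewrite (lt_le_trans ltr01).
  apply: ler_pM.
  - by rewrite exprn_ge0// !mulr_ge0// addr_ge0 ?normc_ge0.
  - by rewrite invr_ge0 exprn_ge0// (le_trans ler01).
  - apply: lerXn2r; rewrite ?nnegrE ?mulr_ge0 ?addr_ge0 ?normc_ge0//.
    by rewrite ler_wpM2l// mulr_ge0.
  - rewrite lef_pV2 ?posrE ?exprn_gt0// ?(lt_le_trans x0)//.
    by apply: lerXn2r; rewrite ?nnegrE ?(ltW x0)// (le_trans ler01).
have x0 : 0 < x by rewrite (lt_le_trans ltr01).
apply: (le_trans (@curve_mean_value R (rdiffs l (rpow s))
  (fun t => - s * rdiffs l (rpow (s + 1)) t) x (x + a%:R) _ xa _ hB)).
  by move=> t /andP[xt _]; apply: curve_deriv_rdiffs; rewrite (lt_le_trans x0).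
have B0 : 0 <= B.
  by rewrite mulr_ge0 ?invr_ge0 ?exprn_ge0 ?mulr_ge0 ?addr_ge0 ?normc_ge0// ltW.
rewrite exprS -[X in _ <= X]mulrA -/B addrAC subrr add0r.
have -> : 2 * (normc s * B) * a%:R = 2 * a%:R * normc s * B by ring.
rewrite ler_wpM2r//; apply: ler_pM; rewrite ?mulr_ge0 ?normc_ge0//.
  by rewrite ler_wpM2l// ler_nat ltnW.
by rewrite lerDl.
Qed.

End RealPowers.

(** * Boundedness and vanishing block sums of a non-trivial character *)

Section CharacterSums.
Variables (R : realType) (q : nat) (chi : nat -> R[i]).
Hypotheses (q0 : (0 < q)%N) (chiP : dirichlet_character q chi)
  (chi_nontriv : nontrivial_character q chi).

Lemma chi_modn n : chi (n %% q)%N = chi n.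
Proof.
have [_ _ per _] := chiP; rewrite [in RHS](divn_eq n q) addnC.
elim: (n %/ q)%N => [|k IH]; first by rewrite mul0n addn0.
by rewrite mulSn addnA addnAC per.
Qed.

Lemma chi_bounded : exists K, forall n, normc (chi n) <= K.
Proof.
exists (\sum_(a < q) normc (chi a)) => n; rewrite -chi_modn.
rewrite (bigD1 (Ordinal (ltn_pmod n q0)))//= lerDl.
by apply: sumr_ge0 => a _; exact: normc_ge0.
Qed.

(** Multiplication by [c] permutes the residues, so the sum equals [chi c] times itself for a [c]
    with [chi c != 1]. *)
Lemma sum_chi : \sum_(a < q) chi a = 0.
Proof.
have [c [cq chi1]] := chi_nontriv; have [_ mul _ _] := chiP.
pose f (a : 'I_q) : 'I_q := Ordinal (ltn_pmod (c * a) q0).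
have finj : injective f.
  have main (a b : 'I_q) : (a <= b)%N -> f a = f b -> a = b.
    move=> ab /(congr1 val) /= /esym /eqP; rewrite eqn_mod_dvd ?leq_mul2l ?ab ?orbT//.
    rewrite -mulnBr Gauss_dvdr; last by rewrite coprime_sym.
    move=> /dvdn_leq; rewrite subn_gt0 leq_subRL// => h.
    apply/val_inj/anti_leq; rewrite ab /= leqNgt; apply/negP => /h.
    by rewrite leqNgt (leq_trans (ltn_ord b))// leq_addl.
  move=> a b; have [ab|/ltnW ba] := leqP a b; first exact: main.
  by move=> /esym /(main _ _ ba).
have E : chi c * \sum_(a < q) chi a = \sum_(a < q) chi a.
  rewrite [RHS](reindex_inj finj) mulr_sumr; apply: eq_bigr => a _.
  by rewrite /= chi_modn mul.
apply/eqP; move/eqP: E; rewrite -subr_eq0 -{2}[\sum_(_ < _) _]mul1r -mulrBl.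
by rewrite mulf_eq0 subr_eq0 (negPf chi1).
Qed.

Lemma sum_chi_shift n : \sum_(a < q) chi (n + a)%N = 0.
Proof.
elim: n => [|n IH]; first exact: sum_chi.
have [_ _ per _] := chiP; move: IH; case: q q0 per => // k _ per.
rewrite big_ord_recl /= addn0 => IH; rewrite big_ord_recr /=.
rewrite addSnnS per addrC; under eq_bigr do rewrite addSnnS.
exact: IH.
Qed.

(** Non-triviality excludes [q = 1], where periodicity would make [chi] constant. This drops the
    term [m = q] of the block sum. *)
Lemma chi0 : chi q = 0.
Proof.
have [c [cq chi1]] := chi_nontriv; have [chi_1 _ per chi_0] := chiP.
apply/eqP; rewrite chi_0 /coprime gcdnn; apply/eqP => q1.
move/eqP: chi1; apply; rewrite -chi_1.
have h n : chi n.+1 = chi n by rewrite -addn1 -[in X in (_ + X)%N]q1 per.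
have e n : chi n = chi 0%N by elim: n => // n; rewrite h.
by rewrite (e c) (e 1%N).
Qed.

End CharacterSums.

(** * The value at a negative integer *)

(** From [1 / (x + 1)^2 <= 1 / x - 1 / (x + 1)]; this is why the sequence starts at [m.+1] and the
    bound involves [m]. *)
Lemma telescoping_bound (R : realType) (u : nat -> R[i]) (D : R) : 0 <= D ->
  (forall n, (0 < n)%N -> normc (u n.+1 - u n) <= D * (n%:R ^+ 2)^-1) ->
  forall m k, (0 < m)%N -> normc (u (m.+1 + k)%N - u m.+1) <= D / m%:R.
Proof.
move=> D0 h m k m0.
suff : normc (u (m.+1 + k)%N - u m.+1) <= D * (m%:R^-1 - (m + k)%:R^-1).
  move=> /le_trans; apply; rewrite ler_wpM2l// lerBlDr lerDl invr_ge0.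
  by rewrite ler0n.
elim: k => [|k IH]; first by rewrite !addn0 !subrr normc0 mulr0.
have x0 : 0 < (m + k)%:R :> R by rewrite ltr0n addn_gt0 m0.
rewrite addnS (_ : _ - _ = (u (m.+1 + k).+1 - u (m.+1 + k)%N) +
  (u (m.+1 + k)%N - u m.+1)); last by ring.
apply: (le_trans (normc_le_add _ _)); apply: (le_trans (lerD (h _ _) IH)) => //.
rewrite -mulrDr ler_wpM2l// addSn -natr1 addnS -natr1.
move: ((m + k)%:R) x0 => x x0.
have -> : m%:R^-1 - (x + 1)^-1 = (x^-1 - (x + 1)^-1) + (m%:R^-1 - x^-1) by ring.
rewrite lerD2r; have x10 : 0 < x + 1 by rewrite addr_gt0.
have -> : x^-1 - (x + 1)^-1 = (x * (x + 1))^-1.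
  by field; rewrite (gt_eqF x0) (gt_eqF x10).
rewrite lef_pV2 ?posrE ?exprn_gt0 ?mulr_gt0//; nra.
Qed.

Lemma prod_binomC (R : realType) (y : R[i]) m :
  \prod_(1 <= i < m.+1) (y - i%:R) / (m`!)%:R = binomC (y - 1) m.
Proof.
rewrite /binomC big_add1 big_mkord /=; congr (_ / _).
by apply: eq_bigr => i _; rewrite -natr1; ring.
Qed.

Section SpecialValue.
Variables (R : realType) (q : nat) (chi : nat -> R[i]) (r : nat).
Hypotheses (q0 : (0 < q)%N) (chiP : dirichlet_character q chi)
  (chi_nontriv : nontrivial_character q chi).
Local Notation C := R[i].

(** Unit discs about points with [Re s >= - r] reach [Re = - r - 1], so [r + 3] differences raise
    the exponent to 2. This also suffices to annihilate [Q], of size at most [r + 2]. *)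
Let j := (r + 3)%N.
Let G (n : nat) (s : C) := iter j (avg q) (dir_partial chi s) n.

Let entire_G n : entire (G n).
Proof.
apply: (@entire_iter_avg R q j (dir_partial chi)) => {}n.
rewrite /dir_partial; apply: entire_sum => i.
have -> : (fun s => chi i * npow_neg i s) = (fun s => chi i * rpow s i%:R).
  by apply/funext => s; rewrite npow_neg_rpow.
exact: entireM (@entire_cst R (chi i)) (@entire_rpow R i%:R).
Qed.

Lemma dir_partialS s n : (0 < n)%N ->
  dir_partial chi s n.+1 - dir_partial chi s n = chi n * rpow s n%:R.
Proof.
by move=> n0; rewrite /dir_partial big_nat_recr//= addrAC subrr add0r npow_neg_rpow.
Qed.

(** Averaging commutes with the shift of index, so the increments of [G] are averages of the single
    terms [chi m * m^(-s)]. *)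
Let G_step s n (K : R) : (forall m, normc (chi m) <= K) -> (0 < n)%N ->
  2 <= complex.Re s + j%:R ->
  normc (G n.+1 s - G n s) <=
  K * (2 * q%:R * (normc s + j%:R)) ^+ j * (n%:R ^+ 2)^-1.
Proof.
move=> hK n0 s2; rewrite /G -iter_avg_shift -iter_avgB.
rewrite (@iter_avg_ext _ _ _ _ (fun m => chi m * rpow s m%:R)); last first.
  by move=> m nm; rewrite dir_partialS// (leq_trans n0).
rewrite -mulrA; apply: (normc_iter_avg_mean_zero q0) => //.
  exact: (sum_chi_shift q0 chiP chi_nontriv).
move=> l lj lq; rewrite (diffs_rdiffs l (rpow s)) -lj.
by apply: normc_rdiffs_rpow => //; rewrite ?ler1n// lj.
Qed.

Let cauchy_G s : - r%:R <= complex.Re s -> cauchy_near G s.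
Proof.
move=> sr e e0; have [K hK] := chi_bounded q0 chiP.
have K0 : 0 <= K by rewrite (le_trans (normc_ge0 (chi 0%N))).
pose D := K * (2 * q%:R * (normc s + 1 + j%:R)) ^+ j.
have D0 : 0 <= D by rewrite mulr_ge0// exprn_ge0// !mulr_ge0// !addr_ge0 ?normc_ge0.
pose m := (Num.bound (2 * D / e)).+1.
have mP : D / m%:R <= e / 2.
  have De : 0 <= 2 * D / e by rewrite divr_ge0 ?(ltW e0)// mulr_ge0.
  have : 2 * D / e <= m%:R.
    by rewrite (le_trans (ltW (archi_boundP De)))// ler_nat.
  by rewrite ler_pdivrMr// ler_pdivrMr ?ltr0n//; nra.
have step w n : normc w <= 1 -> (m.+1 <= n)%N ->
    normc (G n (s + w) - G m.+1 (s + w)) <= e / 2.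
  move=> w1 mn; apply: le_trans mP; rewrite -(subnKC mn).
  apply: (@telescoping_bound R (G^~ (s + w)) D) => // k k0.
  apply: (le_trans (@G_step (s + w) k K hK k0 _)).
    have -> : complex.Re (s + w) = complex.Re s + complex.Re w.
      by case: (s); case: (w).
    have := Re_le_normc w; rewrite ler_norml => /andP[+ _].
    by rewrite /j natrD; lra.
  rewrite ler_wpM2r ?invr_ge0 ?exprn_ge0// ler_wpM2l//.
  apply: lerXn2r; rewrite ?nnegrE ?mulr_ge0 ?addr_ge0 ?normc_ge0//.
  rewrite ler_wpM2l ?mulr_ge0// lerD2r (le_trans (normc_le_add _ _))//.
  by rewrite lerD2l.
exists m.+1 => n1 n2 mn1 mn2 w w1.
rewrite (_ : _ - _ = (G n1 (s + w) - G m.+1 (s + w)) -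
  (G n2 (s + w) - G m.+1 (s + w))); last by ring.
apply: (le_trans (normc_le_sub _ _)).
by rewrite [leRHS]splitr lerD// step.
Qed.

Let Qk k : {poly C} := \prod_(1 <= i < (r.+1 - k).+1) (q%:R^-1 *: 'X - i%:R%:P).
(** Up to an additive constant this is [q^r B_(r+1)(x / q) / (r + 1)], with [B] the Bernoulli
    polynomial. *)
Let Q : {poly C} := \sum_(k < r.+1)
  ((r`!)%:R * q%:R ^+ r * ((-1) ^+ k * alpha k (- r%:R) / ((r.+1 - k)`!)%:R)) *: Qk k.

Let horner_Qk k x : (Qk k).[x] = \prod_(1 <= i < (r.+1 - k).+1) (x / q%:R - i%:R).
Proof.
rewrite /Qk horner_prod; apply: eq_bigr => i _.
by rewrite !hornerE mulrC.
Qed.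

Let size_Q : (size Q <= r + 2)%N.
Proof.
rewrite /Q; apply: (leq_trans (size_sum _ _ _)); apply/bigmax_leqP => k _.
apply: (leq_trans (size_scale_leq _ _)).
apply: (@leq_trans (r.+1 - k).+1); last by rewrite addn2 ltnS leq_subr.
rewrite /Qk; elim: (r.+1 - k)%N => [|n IH]; first by rewrite big_geq// size_poly1.
rewrite big_nat_recr//= (leq_trans (size_polyMleq _ _))//.
have s2 : (size (q%:R^-1 *: 'X - n.+1%:R%:P : {poly C})%R <= 2)%N.
  apply: (leq_trans (size_polyD _ _)); rewrite geq_max size_polyN.
  rewrite (leq_trans (size_scale_leq _ _)) ?size_polyX//.
  by rewrite (leq_trans (size_polyC_leq1 _)).
by rewrite -subn1 leq_subLR (leq_trans (leq_add IH s2))//; lia.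
Qed.

(** With [y = x / q], Pascal's rule reduces the difference of the [k]-th terms to
    [binomC (y - 1) (r - k)], and [power_alpha_binom] sums them. *)
Let Q_diff x : Q.[x + q%:R] - Q.[x] = x ^+ r.
Proof.
have qC0 : q%:R != 0 :> C by rewrite pnatr_eq0 -lt0n.
rewrite -[in RHS](divfK qC0 x) exprMn (power_alpha_binom (x / q%:R)).
rewrite /Q !horner_sum -sumrB mulrAC mulr_sumr; apply: eq_bigr => k _.
rewrite !hornerZ !horner_Qk; set y := x / q%:R.
have -> : (x + q%:R) / q%:R = y + 1 by rewrite mulrDl divff.
have kr : (k <= r)%N by rewrite -ltnS.
have := prod_binomC (y + 1) (r.+1 - k); have := prod_binomC y (r.+1 - k).
rewrite addrK subSn// (binomC_pascal y) => <-.
set A := \prod_(_ <= _ < _) _; set B := \prod_(_ <= _ < _) _; set f := _%:R^-1.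
move=> E; set c := binomC _ _ in E *.
transitivity ((r`!)%:R * q%:R ^+ r * ((-1) ^+ k * alpha k (- r%:R)) * (A * f - B * f)).
  by ring.
by rewrite E; ring.
Qed.

Let U n := \sum_(a < q) chi (n + a)%N * Q.[(n + a)%N%:R].

(** Telescoping: from [U n] to [U n.+1] the block loses the term at [n] and gains the one at
    [n + q], a change of [chi n * (Q (n + q) - Q n) = chi n * n^r]. *)
Let dir_partial_U n : (0 < n)%N -> dir_partial chi (- r%:R) n = U n - U 1.
Proof.
case: n => // n _; elim: n => [|n IH].
  by rewrite subrr /dir_partial big_geq.
rewrite -[LHS](subrK (dir_partial chi (- r%:R) n.+1)) dir_partialS// IH addrA.
congr (_ - _); rewrite rpow_nat ?ltr0n// rmorph_nat -Q_diff.
rewrite /U; have [_ _ per _] := chiP; case: q q0 per => // p _ per.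
rewrite [in LHS]big_ord_recl [in RHS]big_ord_recr /= addn0.
rewrite [in RHS]addSnnS per [in RHS]natrD.
under [in RHS]eq_bigr do rewrite addSnnS.
by under [in LHS]eq_bigr do rewrite /bump /= add1n; ring.
Qed.

(** [U] is [q] times an average of [chi m * Q m], so [j] further averagings annihilate it and only
    the constant [- U 1] survives. *)
Let G_value n : (0 < n)%N -> G n (- r%:R) = - U 1.
Proof.
move=> n0; have [K hK] := chi_bounded q0 chiP.
rewrite /G (@iter_avg_ext _ _ _ _ (fun m => U m - U 1)); last first.
  by move=> m nm; rewrite dir_partial_U// (leq_trans n0).
rewrite iter_avgB (iter_avg_cst q0).
suff -> : iter j (avg q) U n = 0 by rewrite sub0r.
have qC0 : q%:R != 0 :> C by rewrite pnatr_eq0 -lt0n.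
have -> : U = (fun m => q%:R * avg q (fun m => chi m * Q.[m%:R]) m).
  by apply/funext => m; rewrite /avg mulrC divfK.
rewrite iter_avgZ -iterSr (iter_avg_mean_zero_poly q0 _ _ hK) ?mulr0//.
  exact: (sum_chi_shift q0 chiP chi_nontriv).
by rewrite (leq_trans size_Q)// /j; lia.
Qed.

(** [G n] tends to [L] where the Dirichlet series converges to it, hence by [continuation] also at
    [- r], where the sequence is constant for positive [n]. *)
Lemma continuation_value (L : C -> C) : is_L_continuation chi L ->
  L (- r%:R) = - U 1.
Proof.
move=> [hL hcv]; have cv : cseq_cvg (G^~ (- r%:R)) (L (- r%:R)).
  apply: (@continuation R L G (- r%:R)) => //.
    move=> s s1; apply: (iter_avg_cvg q0); apply: cvg_cseq_cvg.
    by apply: hcv; case: s s1.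
  by rewrite -(rmorph_nat (real_complex R)).
apply/esym/eqP; rewrite -subr_eq0; apply/eqP/eq0_normc; apply: le_anti.
rewrite normc_ge0 andbT; apply/ler_addgt0Pr => e e0; rewrite add0r.
have [n0 H] := cv e e0; rewrite -(@G_value n0.+1)//.
exact: H.
Qed.

Lemma neg_block_sum_formula : - U 1 = (r`!)%:R * (q%:R) ^+ r *
    \sum_(k < r.+1)
      ((-1) ^ (k%:Z - 1) * alpha k (- (r%:R)) / ((r.+1 - k)`!)%:R *
       \sum_(1 <= m < q)
         chi m * \prod_(1 <= i < (r.+1 - k).+1) ((m%:R / q%:R) - i%:R)).
Proof.
have -> : U 1 = \sum_(1 <= m < q) chi m * Q.[m%:R].
  have -> : U 1 = \sum_(1 <= m < q.+1) chi m * Q.[m%:R].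
    by rewrite big_add1 big_mkord; apply: eq_bigr => a _; rewrite add1n.
  by rewrite big_nat_recr//= (chi0 chiP chi_nontriv) mul0r addr0.
under eq_bigr do rewrite /Q horner_sum mulr_sumr.
rewrite exchange_big -sumrN mulr_sumr; apply: eq_bigr => k _.
(* The exponent is an integer, equal to -1 at [k = 0]; the sign it contributes is the one in front
   of [U 1]. *)
have -> : (-1) ^ (k%:Z - 1) = - (-1) ^+ k :> C.
  by rewrite expfzDr ?oppr_eq0 ?oner_eq0// exprN1 invrN invr1 mulrN1.
move: (alpha k _) => al; rewrite !mulr_sumr -sumrN; apply: eq_bigr => m _.
by rewrite hornerZ horner_Qk; ring.
Qed.

End SpecialValue.

Unset Implicit Arguments.
Local Close Scope complex_scope.
Local Close Scope classical_set_scope.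

Theorem theorem2 (R : realType) (q : nat) (chi : nat -> R[i]) (r : nat)
    (L : R[i] -> R[i]) :
  (0 < q)%N ->
  dirichlet_character q chi ->
  nontrivial_character q chi ->
  is_L_continuation chi L ->
  L (- (r%:R)) =
    (r`!)%:R * (q%:R) ^+ r *
    \sum_(k < r.+1)
      ((-1) ^ (k%:Z - 1) * alpha k (- (r%:R)) / ((r.+1 - k)`!)%:R *
       \sum_(1 <= m < q)
         chi m * \prod_(1 <= i < (r.+1 - k).+1) ((m%:R / q%:R) - i%:R)).
Proof.
move=> q0 chiP nt /(continuation_value r q0 chiP nt) ->.
exact: neg_block_sum_formula.
Qed.
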